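(* Let $m\ge1$ be an integer, let $\alpha$ be a positive integer with $\alpha\ge m$, and let $M=(M_{i,j})_{i,j=0}^{m-1}$ be a real $m\times m$ matrix. Consider the discrete Laguerre-Sobolev bilinear form on real polynomials $$\langle p,q\rangle=\int_0^\infty p(x)q(x)\,x^{\alpha-m}e^{-x}\,dx+\mathbb{P}(0)\,M\,\mathbb{Q}(0)^T,$$ where $\mathbb{P}(0)=(p(0),\ldots,p^{(m-1)}(0))$ and $\mathbb{Q}(0)=(q(0),\ldots,q^{(m-1)}(0))$. For $l=1,\ldots,m$ define the polynomials $$\mathcal{R}_l(x)=\frac{\Gamma(\alpha-m+l)}{(m-l)!}(x+1)_{m-l}+(l-1)!\,(x+1)_\alpha\sum_{i=0}^{m-1}\frac{(-1)^iM_{l-1,i}}{\Gamma(\alpha+i+1)}(x-i+1)_i ,$$ and let $\Omega(x)=\det\left(\mathcal{R}_i(x-j)\right)_{i,j=1}^m$. Assume that either of the following two equivalent properties holds: (1) $\langle\cdot,\cdot\rangle$ has a sequence of (left) orthogonal polynomials; (2) $\Omega(n)\ne0$ for all integers $n\ge0$. Let $$q_n(x)=\begin{vmatrix} L_n^\alpha(x)&L_{n-1}^\alpha(x)&\cdots&L_{n-m}^\alpha(x)\\ \mathcal{R}_1(n)&\mathcal{R}_1(n-1)&\cdots&\mathcal{R}_1(n-m)\\ \vdots&\vdots&\ddots&\vdots\\ \mathcal{R}_m(n)&\mathcal{R}_m(n-1)&\cdots&\mathcal{R}_m(n-m)\end{vmatrix},\qquad n\ge0$$ (with $L_k^\alpha=0$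 for $k<0$), which are (left) orthogonal polynomials with respect to $\langle\cdot,\cdot\rangle$. Then for any polynomial $S$ there exists a differential operator $D_S$ (explicitly constructed; its expression is given in the context), of order $2(\deg S+\operatorname{\alpha\text{-}wr}(M)+1)$, with respect to which the orthogonal polynomials $(q_n)_n$ are eigenfunctions, where $\operatorname{\alpha\text{-}wr}(M)$ is the $\alpha$-weighted rank of $M$. Moreover, up to an additive constant, the corresponding eigenvalues $(\lambda_n)_n$ of $D_S$ are $\lambda_n=P_S(n)$, where $P_S$ is the polynomial defined by the first order difference equation $$P_S(x)-P_S(x-1)=S(x)\,\Omega(x).$$ In particular, the minimal order of the differential operators having the orthogonal polynomials $(q_n)_n$ as eigenfunctions is at most $2(\operatorname{\alpha\text{-}wr}(M)+1)$.
   Context: $(a)_k=a(a+1)\cdots(a+k-1)$, $(a)_0=1$, is the Pochhammer symbol. $L_n^{\alpha}(x)=\sum_{j=0}^n\frac{(-x)^j}{j!}\binom{n+\alpha}{n-j}$ are the Laguerre polynomials. A sequence of real polynomials $(q_n)_{n\ge0}$ with $\deg q_n=n$ is (left) orthogonal with respect to a (not necessarily symmetric) bilinear form $B$ on real polynomials if, for all $n\ge0$, $B(q_n,q)=0$ for all polynomials $q$ with $\deg q<n$, and $B(q_n,q_n)\ne0$. The order of $\sum_{j=0}^s f_j(d/dx)^j$ is $s$ if $f_s\neq0$. $\alpha$-weighted rank. Let $M$ be an $m\times m$ matrix with columns $c_1,\ldots,c_m$; $\langle\cdots\rangle$ applied to a list of vectors denotes linear span. Define $n_1=\alpha+m-1$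 if $c_m\ne0$ and $n_1=0$ if $c_m=0$; for $j=2,\ldots,m$, define $n_j=\alpha+m-j$ if $c_{m-j+1}\notin\langle c_{m-j+2},\ldots,c_m\rangle$, and $n_j=0$ otherwise. Let $\tilde M$ be the matrix whose columns are those columns $c_i$ of $M$ with $n_{m-i+1}\ne0$ (i.e. the $c_i$ with $c_i\notin\langle c_{i+1},\ldots,c_m\rangle$, kept in the same order). Let $f_1,\ldots,f_m$ be the rows of $\tilde M$. For $j=1,\ldots,m-1$, define $m_j=m-j$ if $f_j\in\langle f_{j+1},\ldots,f_m\rangle$ and $m_j=0$ otherwise. Then $$\operatorname{\alpha\text{-}wr}(M)=\sum_{j=1}^m n_j+\sum_{j=1}^{m-1}m_j-\frac{m(m-1)}{2}.$$ Construction of $D_S$. Let $D_\alpha=-x\left(\frac{d}{dx}\right)^2-(\alpha+1-x)\frac{d}{dx}$, so that $D_\alpha(L_n^\alpha)=nL_n^\alpha$. For $h=1,\ldots,m$ let $$M_h(x)=\sum_{j=1}^m(-1)^{h+j}S(x+j)\det\left(\mathcal{R}_l(x-r)\right)_{l\in\{1,\ldots,m\}\setminus\{h\},\; r\in\{-j+1,-j+2,\ldots,m-j\}\setminus\{0\}}$$ (an empty determinant is $1$). Then $D_S=P_S(D_\alpha)+\sum_{h=1}^mM_h(D_\alpha)\,\frac{d}{dx}\,\mathcal{R}_h(D_\alpha)$.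
   Formalization: The polynomials q_n are proved orthogonal in the second argument, ⟨p,q_n⟩=0 for deg p<n; left orthogonality fails for every non-symmetric M, e.g. m=α=2, M=[[0,1],[-1,0]], n=1. The order claim assumes S≠0, since deg 0 is undefined. *)

(* Defs.v *)
From HB Require Import structures.
From mathcomp Require Import all_boot all_order all_algebra.
From mathcomp Require Import all_classical all_reals all_analysis.
Set Implicit Arguments.
Unset Strict Implicit.
Unset Printing Implicit Defensive.
Import Order.TTheory GRing.Theory Num.Theory.
Local Open Scope classical_set_scope.
Local Open Scope ring_scope.

(* All indices in 'I_m are 0-based: l, h, j, i : 'I_m below stand for the
   indices l+1, h+1, j+1, i+1 of the usual 1-based presentation, except for
   derivative orders and the entries of M, which are 0-based in both. *)

Definition Gamma (R : realType) (x : R) : R :=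
  \int[lebesgue_measure]_(t in `[0, +oo[) (t `^ (x - 1) * expR (- t)).

Definition pochhammer (A : nzRingType) (a : A) (k : nat) : A :=
  \prod_(i < k) (a + i%:R).

Definition laguerre (R : realType) (alpha n : nat) : {poly R} :=
  \sum_(j < n.+1)
    (('C(n + alpha, n - j)%:R / j`!%:R) : R) *: (- 'X) ^+ j.

(* In "deg p < n" the zero polynomial is included: size p = deg p + 1. *)
Definition left_orthogonal (R : realType)
    (B : {poly R} -> {poly R} -> R) (q : nat -> {poly R}) : Prop :=
  forall n : nat,
    [/\ size (q n) = n.+1,
        forall p : {poly R}, (size p <= n)%N -> B (q n) p = 0
      & B (q n) (q n) != 0].

Definition jet0 (R : realType) (m : nat) (p : {poly R}) : 'rV[R]_m :=
  \row_(i < m) (p^`(i)).[0].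

Definition sobolev_form (R : realType) (m alpha : nat) (M : 'M[R]_m)
    (p q : {poly R}) : R :=
  \int[lebesgue_measure]_(x in `[0, +oo[)
     (p.[x] * q.[x] * x ^+ (alpha - m) * expR (- x))
  + (jet0 m p *m M *m (jet0 m q)^T) 0 0.

Definition shiftp (R : realType) (p : {poly R}) (c : R) : {poly R} :=
  p \Po ('X + c%:P).

Definition Rpoly (R : realType) (m alpha : nat) (M : 'M[R]_m) (l : 'I_m) :
    {poly R} :=
  (Gamma (alpha%:R - m%:R + l.+1%:R) / (m - l.+1)`!%:R)
     *: pochhammer ('X + 1) (m - l.+1)
  + l`!%:R *: (pochhammer ('X + 1) alpha *
      \sum_(i < m) ((-1) ^+ i * M l i / Gamma (alpha%:R + i%:R + 1))
                     *: pochhammer ('X - i%:R + 1) i).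

Definition Omega (R : realType) (m alpha : nat) (M : 'M[R]_m) : {poly R} :=
  \det (\matrix_(i < m, j < m) shiftp (Rpoly alpha M i) (- j.+1%:R)).

(* Row 0 holds the Laguerre polynomials, row l+1 the values of R_(l+1).
   Since Rpoly l uses row l of M, these polynomials are orthogonal in the
   second argument of sobolev_form: sobolev_form alpha M p (qdet alpha M n) = 0
   for deg p < n. For M not symmetric they are in general not orthogonal in the
   first one. *)
Definition qdet (R : realType) (m alpha : nat) (M : 'M[R]_m) (n : nat) :
    {poly R} :=
  \det (\matrix_(i < m.+1, j < m.+1)
    if unlift ord0 i is Some l then
      ((Rpoly alpha M l).[n%:R - j%:R])%:P
    else if (j <= n)%N then laguerre R alpha (n - j) else 0).

(* A differential operator is represented by its action on polynomials. The
   coefficients are unique (apply the operator to 1, x, x^2, ...), and so is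
   the order. *)
Definition diffop_order (R : realType) (T : {poly R} -> {poly R}) (s : nat) :
    Prop :=
  exists f : nat -> {poly R}, f s != 0 /\
    forall p : {poly R}, T p = \sum_(j < s.+1) f j * p^`(j).

Definition eigenfunctions (R : realType) (T : {poly R} -> {poly R})
    (q : nat -> {poly R}) : Prop :=
  forall n : nat, exists lambda : R, T (q n) = lambda *: q n.

(* Operators of order 0 are excluded: the constant ones have every polynomial
   as an eigenfunction. *)
Definition minimal_order (R : realType) (q : nat -> {poly R}) (r : nat) :
    Prop :=
  [/\ (0 < r)%N,
      exists T : {poly R} -> {poly R}, diffop_order T r /\ eigenfunctions T q
    & forall (T : {poly R} -> {poly R}) (s : nat),
        (0 < s)%N -> diffop_order T s -> eigenfunctions T q -> (r <= s)%N].

Definition Dalpha (R : realType) (alpha : nat) (p : {poly R}) : {poly R} :=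
  - 'X * p^`(2) - ((alpha%:R + 1)%:P - 'X) * p^`().

Definition poly_op (R : realType) (P : {poly R}) (T : {poly R} -> {poly R})
    (p : {poly R}) : {poly R} :=
  \sum_(i < size P) P`_i *: iter i T p.

(* The columns r in {-j+1, ..., m-j} \ {0} (j 1-based) are r = k - j for k in
   {1, ..., m} \ {j}, in the same order; hence the minor (h, j) below. *)
Definition Mpoly (R : realType) (m alpha : nat) (M : 'M[R]_m) (S : {poly R})
    (h : 'I_m) : {poly R} :=
  \sum_(j < m) (-1) ^+ (h + j) * shiftp S j.+1%:R *
    \det (row' h (col' j
      (\matrix_(l < m, k < m) shiftp (Rpoly alpha M l) (- (k%:R - j%:R))))).

Definition DS (R : realType) (m alpha : nat) (M : 'M[R]_m)
    (S P : {poly R}) (p : {poly R}) : {poly R} :=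
  poly_op P (Dalpha alpha) p
  + \sum_(h < m) poly_op (Mpoly alpha M S h) (Dalpha alpha)
                   (poly_op (Rpoly alpha M h) (Dalpha alpha) p)^`().

(* For i : 'I_m this is n_j with j = m - i, attached to the column c_(i+1);
   for the last column the span is that of the empty list, i.e. 0. *)
Definition wr_n (R : realType) (m alpha : nat) (M : 'M[R]_m) (i : 'I_m) :
    nat :=
  if col i M \in <<[seq col k M | k : 'I_m <- enum 'I_m & (i < k)%N]>>%VS
  then 0%N else (alpha + i)%N.

Definition wr_cols (R : realType) (m alpha : nat) (M : 'M[R]_m) :
    {set 'I_m} :=
  [set i | wr_n alpha M i != 0%N]%SET.

(* enum_val is increasing, so the columns are kept in the same order. *)
Definition wr_tilde (R : realType) (m alpha : nat) (M : 'M[R]_m) :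
    'M[R]_(m, #|wr_cols alpha M|) :=
  colsub (fun k : 'I_#|wr_cols alpha M| => enum_val k) M.

(* For j : 'I_m this is m_(j+1); the last one, j = m - 1, is always 0, so the
   sum over 'I_m in alpha_wr is the sum over the first m - 1 rows. *)
Definition wr_m (R : realType) (m alpha : nat) (M : 'M[R]_m) (j : 'I_m) :
    nat :=
  let Mt := wr_tilde alpha M in
  if row j Mt \in <<[seq row k Mt | k : 'I_m <- enum 'I_m & (j < k)%N]>>%VS
  then (m - j.+1)%N else 0%N.

Definition alpha_wr (R : realType) (m alpha : nat) (M : 'M[R]_m) : int :=
  ((\sum_(i < m) wr_n alpha M i)%N)%:Z + ((\sum_(j < m) wr_m alpha M j)%N)%:Z
  - (((m * (m - 1)) %/ 2)%N)%:Z.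

(* Main.v *)
Require Import Defs.
From HB Require Import structures.
From mathcomp Require Import all_boot all_order all_algebra.
From mathcomp Require Import all_classical all_reals all_analysis.
From mathcomp Require Import perm measurable_realfun.
From mathcomp Require Import zify ring.
Set Implicit Arguments.
Unset Strict Implicit.
Unset Printing Implicit Defensive.
Import Order.TTheory GRing.Theory Num.Theory.
Local Open Scope ring_scope.

(** Three facts carry the proof.

    Orthogonality.  Integration against [x ^ b * exp (- x)] turns the pairing of
    a monomial with a Laguerre polynomial into an alternating binomial sum
    ([altbin]).  For monomials of degree [l < m], the pairing with the Laguerre
    polynomial of index [k] is exactly [Rpoly l] at [k] ([sobolev_Xn_small]);
    for higher monomials it vanishes in the classical way.  So pairing a monomial
    of low degree with [qdet n] repeats a row of the determinant and gives 0.
    The pairing of [x ^ n] with [qdet n] is a nonzero multiple of [Omega (n + 1)]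
    and the leading coefficient of [qdet n] is a nonzero multiple of [Omega n];
    hence orthogonal polynomials exist if and only if [Omega] has no zero among
    the natural numbers.

    Eigenfunctions.  [Dalpha] is diagonal on Laguerre polynomials, and the
    derivative of a Laguerre polynomial is minus the sum of all those of lower
    index.  Writing [qdet n] in the Laguerre basis, the eigenvalue equation
    becomes an identity between Casorati determinants at a single point
    ([casorati_weight_eigen]).  The polynomials [Mpoly] are sums of shifted
    adjugate entries of the Casorati matrix, and the adjugate is the inverse up
    to the determinant [Omega]; this produces a telescoping sum of [S * Omega],
    that is, a difference of values of [P].

    Order.  The operator [P(Dalpha)] has order [2 * deg P].  The other part of
    [DS] depends bilinearly on the rows of the Casorati matrix, so it may be
    computed in any basis of the span of the [Rpoly]; in a basis of pairwise
    distinct degrees [d l] ([distinct_degrees]), replacing shifts by iterated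
    differences shows both that [deg Omega] is the sum of the [d l] minus
    [m * (m - 1) / 2] ([size_det_casorati]) and that the coefficients satisfy
    [deg (krallM l) + d l <= deg S + deg Omega] ([size_krallM]).  Therefore
    this part has order at most [2 * deg P - 1].  Finally the [d l] are the
    degrees that occur in the span of the [Rpoly], and these are read off from
    the column and row dependencies of [M] ([degree_sum_alpha_wr]); their sum is
    the one in the definition of the weighted rank. *)

(** * The moment functional of the exponential weight *)

(** Integration against [exp (-x)] over the half line sends [X^i] to [i!]; in
    this form it is a purely algebraic functional. *)
Definition moment (R : realType) (p : {poly R}) : R :=
  \sum_(i < size p) p`_i * i`!%:R.

Lemma moment_widen (R : realType) (p : {poly R}) n :
  (size p <= n)%N -> moment p = \sum_(i < n) p`_i * i`!%:R.
Proof.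
move=> le_pn; rewrite /moment (big_ord_widen n (fun i => p`_i * i`!%:R)) //.
rewrite big_mkcond; apply: eq_bigr => i _; case: ltnP => // le_pi.
by rewrite nth_default ?mul0r.
Qed.

Lemma momentD (R : realType) (p q : {poly R}) :
  moment (p + q) = moment p + moment q.
Proof.
pose n := maxn (size p) (size q).
rewrite (@moment_widen _ p n) ?leq_maxl // (@moment_widen _ q n) ?leq_maxr //.
rewrite (@moment_widen _ (p + q) n) ?size_polyD // -big_split /=.
by apply: eq_bigr => i _; rewrite coefD mulrDl.
Qed.

Lemma momentZ (R : realType) (a : R) (p : {poly R}) :
  moment (a *: p) = a * moment p.
Proof.
rewrite (@moment_widen _ (a *: p) (size p)) ?size_scale_leq // mulr_sumr.
by apply: eq_bigr => i _; rewrite coefZ mulrA.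
Qed.

Lemma moment0 (R : realType) : moment (0 : {poly R}) = 0.
Proof. by rewrite /moment size_poly0 big_ord0. Qed.

Lemma moment_sum (R : realType) (I : Type) (r : seq I) (P : pred I)
    (F : I -> {poly R}) :
  moment (\sum_(i <- r | P i) F i) = \sum_(i <- r | P i) moment (F i).
Proof. by apply: big_morph; [apply: momentD | apply: moment0]. Qed.

Lemma momentXn (R : realType) n : moment ('X^n : {poly R}) = n`!%:R.
Proof.
rewrite (@moment_widen _ _ n.+1) ?size_polyXn // big_ord_recr /= big1 ?add0r.
  by rewrite coefXn eqxx mul1r.
by move=> i _; rewrite coefXn ltn_eqF ?mul0r.
Qed.

(** A primitive of [x^k exp (-x)] is [- p_k(x) exp (-x)] for this [p_k]. *)
Fixpoint exp_primitive (R : realType) (k : nat) : {poly R} :=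
  if k is j.+1 then 'X^k + k%:R *: exp_primitive R j else 1.

Lemma exp_primitive_deriv (R : realType) k :
  exp_primitive R k - (exp_primitive R k)^`() = 'X^k.
Proof.
elim: k => [|k IHk] /=; first by rewrite derivC subr0 expr0.
rewrite derivD derivXn derivZ /= -(scaler_nat k.+1 'X^k) -IHk scalerBr.
by rewrite subrK addrK.
Qed.

Lemma exp_primitive0 (R : realType) k : (exp_primitive R k).[0] = k`!%:R.
Proof.
elim: k => [|k IHk] /=; first by rewrite hornerC.
by rewrite !hornerE IHk expr0n /= add0r factS natrM.
Qed.

Section ExponentialIntegrals.
Local Open Scope classical_set_scope.
Local Open Scope ring_scope.
Import numFieldNormedType.Exports.

Lemma horner_expRN_cvg0 (R : realType) (p : {poly R}) :
  (fun x : R => p.[x] * expR (- x)) x @[x --> +oo] --> (0 : R).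
Proof.
have mono n : (fun x : R => x ^+ n * expR (- x)) x @[x --> +oo] --> (0 : R).
  apply/cvgrPdist_le => e e0; near=> x.
  have x0 : 0 < x by near: x; apply: nbhs_pinfty_gt; exact: num_real.
  rewrite sub0r normrN ger0_norm ?mulr_ge0 ?exprn_ge0 ?expR_ge0 ?(ltW x0) //.
  rewrite expRN ler_pdivrMr ?expR_gt0 //.
  have := @expR_ge1Dxn R x n (ltW x0).
  move=> h; have {h} : x ^+ n.+1 / n.+1`!%:R <= expR x.
    by apply: le_trans h; rewrite lerDr.
  move=> h; apply: (@le_trans _ _ (e * (x ^+ n.+1 / n.+1`!%:R))); last first.
    by rewrite ler_pM2l.
  rewrite exprSr -mulrA mulrCA ler_peMr ?exprn_ge0 ?(ltW x0) //.
  have f0 : 0 < n.+1`!%:R :> R by rewrite ltr0n fact_gt0.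
  rewrite mulrA ler_pdivlMr // mul1r -ler_pdivrMl //.
have -> : (fun x : R => p.[x] * expR (- x)) =
    (fun x => \sum_(i < size p) p`_i * (x ^+ i * expR (- x))).
  apply/funext => x; rewrite horner_coef mulr_suml.
  by apply: eq_bigr => i _; rewrite mulrA.
elim: (size p) => [|n IHn].
  by under eq_fun do rewrite big_ord0; exact: cvg_cst.
under eq_fun do rewrite big_ord_recr /=.
by have := cvgD IHn (cvgM (cvg_cst p`_n) (mono n)); rewrite mulr0 addr0; exact.
Unshelve. all: end_near. Qed.

Lemma derive_horner_expRN (R : realType) (p : {poly R}) (x : R) :
  is_derive x 1 (fun x : R => - (p.[x] * expR (- x)))
    ((p - p^`()).[x] * expR (- x)).
Proof.
apply: is_derive_eq.
rewrite !hornerE.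
by rewrite /GRing.scale /=; ring.
Qed.

Lemma integral_Xn_expRN (R : realType) k :
  (\int[lebesgue_measure]_(x in `[0%R, +oo[) (x ^+ k * expR (- x))%:E =
     (k`!%:R : R)%:E)%E.
Proof.
pose p := exp_primitive R k.
have dF (x : R) : is_derive x 1 (fun x : R => - (p.[x] * expR (- x)))
    (x ^+ k * expR (- x)).
  by have := derive_horner_expRN p x; rewrite exp_primitive_deriv hornerXn.
have cF : continuous (fun x : R => - (p.[x] * expR (- x))).
  move=> x; apply: differentiable_continuous; apply/derivable1_diffP.
  by have [] := dF x.
have cf : continuous (fun x : R => x ^+ k * expR (- x)).
  move=> x; apply: cvgM; first exact: exprn_continuous.
  apply: continuous_comp; first exact: opp_continuous.
  exact: continuous_expR.
rewrite (@ge0_continuous_FTC2y R _ (fun x : R => - (p.[x] * expR (- x))) 0 0).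
- by rewrite oppr0 expR0 mulr1 exp_primitive0 EFinN oppeK add0e.
- by move=> x x0; rewrite mulr_ge0 ?exprn_ge0 ?expR_ge0.
- exact: continuous_subspaceT.
- by have := cvgN (@horner_expRN_cvg0 R p); rewrite oppr0; exact.
- by move=> x _; have [] := dF x.
- by apply: cvg_at_right_filter; exact: cF.
- by move=> x _; rewrite derive1E; have [] := dF x.
Qed.

Lemma integrable_Xn_expRN (R : realType) k :
  lebesgue_measure.-integrable (`[0, +oo[ : set R)
    (EFin \o (fun x : R => x ^+ k * expR (- x))).
Proof.
apply/integrableP; split.
  apply/measurable_EFinP; apply: (@measurable_funS _ _ _ _ setT) => //.
  apply: measurable_funM; first exact: exprn_measurable.
  by apply: measurableT_comp => //; exact: measurable_expR.
under eq_integral.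
  move=> x; rewrite inE /= in_itv /= andbT => x0.
  rewrite ger0_norm ?mulr_ge0 ?exprn_ge0 ?expR_ge0 //.
  over.
by rewrite integral_Xn_expRN ltry.
Qed.

Lemma Rintegral_horner_expRN (R : realType) (p : {poly R}) :
  \int[lebesgue_measure]_(x in `[0, +oo[) (p.[x] * expR (- x)) = moment p.
Proof.
suff aux n : lebesgue_measure.-integrable (`[0, +oo[ : set R)
      (EFin \o (fun x : R => (\sum_(i < n) p`_i * x ^+ i) * expR (- x))) /\
    \int[lebesgue_measure]_(x in `[0, +oo[)
      ((\sum_(i < n) p`_i * x ^+ i) * expR (- x)) =
    \sum_(i < n) p`_i * i`!%:R.
  rewrite /moment -(aux (size p)).2; apply: eq_Rintegral => x _.
  by rewrite horner_coef.
elim: n => [|n [IHi IHe]].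
  split.
    rewrite (_ : EFin \o _ = fun=> 0%E).
      by apply: integrable0; exact: measurable_itv.
    by apply/funext => x /=; rewrite big_ord0 mul0r.
  under eq_Rintegral do rewrite big_ord0 mul0r.
  by rewrite big_ord0 Rintegral_cst //= mul0r.
have iX : lebesgue_measure.-integrable (`[0, +oo[ : set R)
    (EFin \o (fun x : R => p`_n * (x ^+ n * expR (- x)))).
  rewrite (_ : EFin \o _ = fun x => (p`_n)%:E * (x ^+ n * expR (- x))%:E)%E.
    by apply: integrableZl (@integrable_Xn_expRN R n); exact: measurable_itv.
  by apply/funext => x /=; rewrite EFinM.
have E x : (\sum_(i < n.+1) p`_i * x ^+ i) * expR (- x) =
   (\sum_(i < n) p`_i * x ^+ i) * expR (- x) + p`_n * (x ^+ n * expR (- x)).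
  by rewrite big_ord_recr /= mulrDl mulrA.
split.
  rewrite (_ : EFin \o _ = fun x =>
    ((\sum_(i < n) p`_i * x ^+ i) * expR (- x))%:E +
     (p`_n * (x ^+ n * expR (- x)))%:E)%E; last first.
    by apply/funext => x /=; rewrite E EFinD.
  by have := integrableD _ IHi iX; apply; exact: measurable_itv.
under eq_Rintegral do rewrite E.
rewrite RintegralD //= IHe RintegralZl //=; last exact: integrable_Xn_expRN.
by rewrite big_ord_recr /= /Rintegral integral_Xn_expRN.
Qed.

End ExponentialIntegrals.

Lemma Gamma_natS (R : realType) (n : nat) : Gamma (n.+1%:R : R) = n`!%:R.
Proof.
rewrite /Gamma -(@momentXn R n) -Rintegral_horner_expRN.
apply: eq_Rintegral => x; rewrite inE /= in_itv /= andbT => x0.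
by rewrite hornerXn -powR_mulrn // -natr1 addrK.
Qed.

Lemma sobolev_formE (R : realType) (m alpha : nat) (M : 'M[R]_m)
    (p q : {poly R}) :
  sobolev_form alpha M p q =
  moment (p * q * 'X^(alpha - m)) + (jet0 m p *m M *m (jet0 m q)^T) 0 0.
Proof.
rewrite /sobolev_form -Rintegral_horner_expRN; congr (_ + _).
by apply: eq_Rintegral => x _; rewrite !hornerM hornerXn.
Qed.

(** * Laguerre polynomials *)

Lemma natr_fact_neq0 (R : numDomainType) (n : nat) : n`!%:R != 0 :> R.
Proof. by rewrite pnatr_eq0 -lt0n fact_gt0. Qed.

Lemma coef_laguerre (R : realType) (a n i : nat) :
  (laguerre R a n)`_i =
  if (i <= n)%N then (-1) ^+ i * 'C(n + a, n - i)%:R / i`!%:R else 0.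
Proof.
have E (j : nat) : ('C(n + a, n - j)%:R / j`!%:R : R) *: (- 'X) ^+ j =
    ((-1) ^+ j * 'C(n + a, n - j)%:R / j`!%:R) *: 'X^j.
  have N1 : (-1 : {poly R}) = (-1)%:P by rewrite polyCN.
  by rewrite (exprNn 'X) N1 -polyC_exp mul_polyC scalerA mulrC mulrA.
rewrite /laguerre coef_sum; under eq_bigr do rewrite E coefZ coefXn.
case: leqP => [le_in | lt_ni].
  rewrite (bigD1 (Ordinal (le_in : (i < n.+1)%N))) //= eqxx mulr1 big1 ?addr0 //.
  move=> j /eqP ne_ji; case: eqP => [e|_]; last by rewrite mulr0.
  by case: ne_ji; apply: val_inj.
rewrite big1 // => j _; rewrite gtn_eqF ?mulr0 //.
exact: leq_trans (ltn_ord j) lt_ni.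
Qed.

Lemma size_laguerre (R : realType) (a n : nat) : size (laguerre R a n) = n.+1.
Proof.
apply/eqP; rewrite eqn_leq; apply/andP; split.
  by apply/leq_sizeP => j lt_nj; rewrite coef_laguerre leqNgt lt_nj.
rewrite ltnNge; apply: contraTN isT => /leq_sizeP/(_ n (leqnn n)).
rewrite coef_laguerre leqnn subnn bin0 mulr1 => /eqP.
by rewrite mulf_eq0 signr_eq0 invr_eq0 (negPf (natr_fact_neq0 _ _)).
Qed.

Lemma laguerre_derivS (R : realType) (a n : nat) :
  (laguerre R a n.+1)^`() = (laguerre R a n)^`() - laguerre R a n.
Proof.
apply/polyP => i; rewrite coefB !coef_deriv !coef_laguerre ltnS.
case: (ltngtP i n) => [lt_in | lt_ni | ->]; last 2 first.
- by rewrite !mul0rn subr0.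
- rewrite mul0rn sub0r !subnn !bin0 !mulr1.
  rewrite factS natrM -mulr_natr exprS mulN1r.
  have f0 : n`!%:R != 0 :> R by exact: natr_fact_neq0.
  have n0 : n.+1%:R != 0 :> R by rewrite pnatr_eq0.
  by field; rewrite f0 -natr1 in n0 *; rewrite addrC.
have -> : 'C(n.+1 + a, n.+1 - i.+1) = ('C(n + a, n - i) + 'C(n + a, n - i.+1))%N.
  by rewrite addSn subSS (_ : n - i = (n - i.+1).+1)%N ?binS //; lia.
move: 'C(n + a, n - i) 'C(n + a, n - i.+1) => u v.
rewrite [(i.+1)`!]factS [(i.+1 * _)%:R]natrM [(u + v)%:R]natrD.
rewrite [_ ^+ i.+1]exprS mulN1r.
have f0 : i`!%:R != 0 :> R by exact: natr_fact_neq0.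
have n0 : i.+1%:R != 0 :> R by rewrite pnatr_eq0.
by field; rewrite f0 -natr1 in n0 *; rewrite addrC.
Qed.

(** The coefficients of two consecutive Laguerre polynomials satisfy Pascal's
    rule, so the derivatives telescope. *)
Lemma laguerre_deriv (R : realType) (a n : nat) :
  (laguerre R a n)^`() = - \sum_(j < n) laguerre R a j.
Proof.
elim: n => [|n IHn].
  by rewrite big_ord0 oppr0; apply/polyP => i; rewrite coef_deriv coef_laguerre coef0 mul0rn.
rewrite laguerre_derivS IHn big_ord_recr /= opprD //.
Qed.

Lemma coef_Dalpha (R : realType) (a i : nat) (p : {poly R}) :
  (Dalpha a p)`_i = i%:R * p`_i - i.+1%:R * (i + a).+1%:R * p`_i.+1.
Proof.
rewrite /Dalpha mulrBl opprB mulNr !coefD !coefN !coefCM !coefXM.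
rewrite !derivnS derivn0 !coef_deriv.
case: i => [|i] /=; first by rewrite oppr0 mulr1n !add0r add0n; ring.
ring.
Qed.

(** In the basis of monomials [Dalpha] is lower bidiagonal, so the Laguerre
    equation is one Pascal-type relation between consecutive coefficients. *)
Lemma Dalpha_laguerre (R : realType) (a n : nat) :
  Dalpha a (laguerre R a n) = n%:R *: laguerre R a n.
Proof.
apply/polyP => i; rewrite coef_Dalpha coefZ !coef_laguerre.
case: (ltngtP i n) => [lt_in | lt_ni | ->]; last 2 first.
- by rewrite !mulr0 subr0.
- by rewrite mulr0 subr0.
have := mul_bin_left (n + a) (n - i.+1).
have -> : (n - i.+1).+1 = (n - i)%N by lia.
have -> : (n + a - (n - i.+1))%N = (i + a).+1 by lia.
move=> /(congr1 (fun k : nat => k%:R : R)) H; rewrite !natrM in H.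
have fi : i`!%:R != 0 :> R by exact: natr_fact_neq0.
have i0 : i.+1%:R != 0 :> R by rewrite pnatr_eq0.
rewrite [(i.+1)`!]factS [(i.+1 * _)%:R]natrM exprS mulN1r.
apply: (@mulIf _ i`!%:R) => //.
transitivity ((-1) ^+ i * (i%:R * 'C(n + a, n - i)%:R
                 + (i + a).+1%:R * 'C(n + a, n - i.+1)%:R) : R).
  by field; rewrite fi addrC natr1 i0.
rewrite -H natrB ?(ltnW lt_in) //; field; exact: fi.
Qed.

(** * Alternating binomial sums and Laguerre moments *)

(** The coefficient of [t ^ k] in [(1 + t) ^ a * (1 + t) ^ (- b - 1)], written as
    a convolution; hence it depends only on [a - b]. *)
Definition altbin (R : pzRingType) (k a b : nat) : R :=
  \sum_(j < k.+1) (-1) ^+ j * 'C(a, k - j)%:R * 'C(b + j, j)%:R.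

Lemma altbin0 (R : pzRingType) (a b : nat) : altbin R 0 a b = 1.
Proof. by rewrite /altbin big_ord1 subn0 !bin0 !mulr1. Qed.

Lemma altbinSl (R : comPzRingType) (k a b : nat) :
  altbin R k.+1 a.+1 b = altbin R k.+1 a b + altbin R k a b.
Proof.
rewrite /altbin big_ord_recr [in RHS]big_ord_recr /= !subnn !bin0.
rewrite -addrA [X in _ = _ + X]addrC addrA; congr (_ + _).
rewrite -big_split /=; apply: eq_bigr => j _.
by rewrite subSn -1?ltnS // binS natrD mulrDr mulrDl.
Qed.

Lemma altbinSr (R : comPzRingType) (k a b : nat) :
  altbin R k.+1 a b.+1 = altbin R k.+1 a b - altbin R k a b.+1.
Proof.
rewrite /altbin big_ord_recl [in RHS]big_ord_recl /= !addn0 !bin0 -addrA.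
congr (_ + _); rewrite -sumrB; apply: eq_bigr => j _.
rewrite /bump /= add1n subSS addSn addnS binS natrD addSn exprS; ring.
Qed.

Lemma altbinSS (R : comPzRingType) (k a b : nat) :
  altbin R k a.+1 b.+1 = altbin R k a b.
Proof.
case: k => [|k]; first by rewrite !altbin0.
by rewrite altbinSl altbinSr subrK.
Qed.

Lemma altbin_diag (R : comPzRingType) (k a b : nat) :
  altbin R k (b + a) b = altbin R k a 0.
Proof. by elim: b => [|b IHb] //; rewrite addSn altbinSS. Qed.

Lemma altbin_eq (R : comPzRingType) (k b : nat) :
  altbin R k b b = (-1) ^+ k.
Proof.
rewrite -{1}[b]addn0 altbin_diag /altbin big_ord_recr /= subnn add0n !binn.
rewrite !mulr1 big1 ?add0r // => j _.
by rewrite bin0n subn_eq0 leqNgt ltn_ord mulr0 mul0r.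
Qed.

Lemma altbin_lt (R : comPzRingType) (k b c : nat) :
  altbin R k (b + c.+1) b = 'C(c, k)%:R.
Proof.
rewrite altbin_diag; elim: k => [|k IHk]; first by rewrite altbin0 bin0.
rewrite {1}/altbin big_ord_recl /= mul1r bin0 mulr1 subn0.
rewrite (_ : \sum_(i < _) _ = - altbin R k c.+1 0).
  by rewrite IHk binS natrD addrK.
rewrite /altbin -sumrN; apply: eq_bigr => j _.
by rewrite /bump /= add1n subSS exprS !add0n !binn; ring.
Qed.

Lemma moment_Xn_laguerre (R : realType) (a b k : nat) :
  moment ('X^b * laguerre R a k) = b`!%:R * altbin R k (k + a) b.
Proof.
rewrite (_ : 'X^b * _ = \sum_(j < k.+1) (laguerre R a k)`_j *: 'X^(b + j)).
  rewrite moment_sum /altbin mulr_sumr; apply: eq_bigr => j _.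
  rewrite momentZ momentXn coef_laguerre -ltnS ltn_ord.
  have fj : j`!%:R != 0 :> R by exact: natr_fact_neq0.
  rewrite -(@bin_fact (b + j) j) ?leq_addl // addnK !natrM; field; exact: fj.
rewrite -{1}[laguerre R a k]coefK size_laguerre poly_def mulr_sumr.
by apply: eq_bigr => j _; rewrite -scalerAr -exprD.
Qed.

(** * Casorati determinants *)

Lemma horner_shiftp (R : realType) (p : {poly R}) (c x : R) :
  (shiftp p c).[x] = p.[x + c].
Proof. by rewrite /shiftp horner_comp !hornerE. Qed.

Definition casorati (R : realType) (m : nat) (r : 'I_m -> {poly R}) :
    'M[{poly R}]_m :=
  \matrix_(l < m, k < m) shiftp (r l) (- k.+1%:R).

Lemma horner_det (R : realType) (m : nat) (A : 'M[{poly R}]_m) (x : R) :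
  (\det A).[x] = \det (map_mx (horner^~ x) A).
Proof. by rewrite -/(horner_eval x (\det A)) -det_map_mx. Qed.

Lemma horner_casorati (R : realType) (m : nat) (r : 'I_m -> {poly R}) (x : R) :
  map_mx (horner^~ x) (casorati r) = \matrix_(l, k) (r l).[x - k.+1%:R].
Proof. by apply/matrixP => l k; rewrite !mxE horner_shiftp. Qed.

Definition casorati_border (R : realType) (m : nat) (r : 'I_m -> {poly R})
    (x : R) (w : 'I_m.+1 -> R) : 'M[R]_m.+1 :=
  \matrix_(i, j)
    if unlift ord0 i is Some l then (r l).[x - j%:R] else w j.

(** Up to sign, the maximal minors of the window of [m + 1] points; they do not
    depend on the top row, here 0. *)
Definition casorati_weight (R : realType) (m : nat) (r : 'I_m -> {poly R})
    (x : R) (j : 'I_m.+1) : R :=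
  cofactor (casorati_border r x (fun=> 0)) ord0 j.

Lemma det_casorati_border (R : realType) (m : nat) (r : 'I_m -> {poly R})
    (x : R) (w : 'I_m.+1 -> R) :
  \det (casorati_border r x w) = \sum_j w j * casorati_weight r x j.
Proof.
rewrite (expand_det_row _ ord0); apply: eq_bigr => j _.
rewrite !mxE unlift_none; congr (_ * (_ * \det _)).
by apply/matrixP => a b; rewrite !mxE liftK.
Qed.

Lemma casorati_weight_orth (R : realType) (m : nat) (r : 'I_m -> {poly R})
    (x : R) (l : 'I_m) :
  \sum_(j < m.+1) (r l).[x - j%:R] * casorati_weight r x j = 0.
Proof.
rewrite -det_casorati_border.
apply: (@determinant_alternate _ _ _ ord0 (lift ord0 l)); first exact: neq_lift.
by move=> j; rewrite !mxE unlift_none liftK.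
Qed.

Lemma casorati_weight0 (R : realType) (m : nat) (r : 'I_m -> {poly R}) (x : R) :
  casorati_weight r x ord0 = (\det (casorati r)).[x].
Proof.
rewrite /casorati_weight /cofactor expr0 mul1r horner_det horner_casorati.
congr (\det _); apply/matrixP => a b; rewrite !mxE liftK.
by rewrite lift0.
Qed.

Lemma casorati_weight_max (R : realType) (m : nat) (r : 'I_m -> {poly R})
    (x : R) :
  casorati_weight r x ord_max = (-1) ^+ m * (\det (casorati r)).[x + 1].
Proof.
rewrite /casorati_weight /cofactor add0n horner_det horner_casorati.
congr (_ * \det _); apply/matrixP => a b; rewrite !mxE liftK lift_max.
by congr (_.[_]); rewrite -natr1; ring.
Qed.

Lemma qdetE (R : realType) (m alpha : nat) (M : 'M[R]_m) (n : nat) :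
  qdet alpha M n =
  \sum_(j < m.+1) casorati_weight (Rpoly alpha M) n%:R j *:
    (if (j <= n)%N then laguerre R alpha (n - j) else 0).
Proof.
rewrite /qdet (expand_det_row _ ord0); apply: eq_bigr => j _.
rewrite mxE unlift_none -mul_polyC mulrC; congr (_ * _).
rewrite /casorati_weight /cofactor polyCM polyC_exp polyCN -det_map_mx.
congr (_ * \det _); apply/matrixP => a b.
by rewrite !mxE liftK.
Qed.

Lemma Omega_casorati (R : realType) (m alpha : nat) (M : 'M[R]_m) :
  Omega alpha M = \det (casorati (Rpoly alpha M)).
Proof. by []. Qed.

(** * Values of [Rpoly] at integers *)

Lemma horner_pochhammer (R : realType) (p : {poly R}) (k : nat) (x : R) :
  (pochhammer p k).[x] = pochhammer p.[x] k.
Proof.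
rewrite /pochhammer horner_prod; apply: eq_bigr => i _.
by rewrite hornerD -polyC_natr hornerC.
Qed.

Lemma pochhammer_nat (R : realType) (n d : nat) :
  pochhammer (n.+1%:R : R) d = (n + d)`!%:R / n`!%:R.
Proof.
have n0 := natr_fact_neq0 R n.
rewrite /pochhammer; elim: d => [|d IHd]; first by rewrite big_ord0 addn0 divff.
rewrite big_ord_recr /= IHd addnS [(_.+1)`!]factS [(_.+1 * _)%:R]natrM.
rewrite -addSn natrD; field; exact: n0.
Qed.

Lemma pochhammer_eq0 (R : realType) (x : R) (d : nat) (i : 'I_d) :
  x + i%:R = 0 -> pochhammer x d = 0.
Proof. by move=> h; rewrite /pochhammer (bigD1 i) //= h mul0r. Qed.

(** At natural numbers the rising factorials become quotients of factorials, and
    the two parts of [Rpoly] become the two parts of a pairing with a Laguerre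
    polynomial: the integral and the derivatives at 0. *)
Lemma Rpoly_nat (R : realType) (m alpha : nat) (M : 'M[R]_m) (l : 'I_m) n :
  (m <= alpha)%N ->
  (Rpoly alpha M l).[n%:R] =
  (alpha - m + l)`!%:R * 'C(n + (m - l.+1), n)%:R +
  l`!%:R * \sum_(i < m) M l i *
    (if (i <= n)%N then (-1) ^+ i * 'C(n + alpha, n - i)%:R else 0).
Proof.
move=> le_ma; rewrite /Rpoly hornerD !hornerZ hornerM !horner_pochhammer.
have -> : ('X + 1 : {poly R}).[n%:R] = n.+1%:R by rewrite !hornerE natr1.
rewrite !pochhammer_nat horner_sum.
have -> : alpha%:R - m%:R + l.+1%:R = (alpha - m + l).+1%:R :> R.
  by rewrite -natrB // -natrD addnS.
rewrite Gamma_natS; congr (_ + _).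
  rewrite -!mulrA; congr (_ * _).
  have := @bin_fact (n + (m - l.+1)) n (leq_addr _ _); rewrite addKn.
  move=> /(congr1 (fun k : nat => k%:R : R)) <-.
  have := natr_fact_neq0 R n; have := natr_fact_neq0 R (m - l.+1).
  rewrite !natrM => h1 h2; field; by rewrite h1 h2.
congr (_ * _); rewrite mulr_sumr; apply: eq_bigr => i _.
rewrite hornerZ horner_pochhammer.
have -> : ('X - i%:R + 1 : {poly R}).[n%:R] = n%:R - i%:R + 1.
  by rewrite -polyC_natr !hornerE.
have -> : alpha%:R + i%:R + 1 = (alpha + i).+1%:R :> R.
  by rewrite -natr1 natrD.
rewrite Gamma_natS.
have n0 := natr_fact_neq0 R n.
have ai0 := natr_fact_neq0 R (alpha + i).
case: (leqP i n) => [le_in | lt_ni]; last first.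
  have lt_i : (i - n.+1 < i)%N by lia.
  rewrite [pochhammer (_ + 1) _](@pochhammer_eq0 _ _ _ (Ordinal lt_i)) ?mulr0 //=.
  by rewrite natrB // -natr1; ring.
have -> : n%:R - i%:R + 1 = (n - i).+1%:R :> R by rewrite -natr1 natrB.
rewrite pochhammer_nat subnK //.
have := @bin_fact (n + alpha) (n - i) _.
have -> : (n + alpha - (n - i))%N = (alpha + i)%N by lia.
move=> /(_ _) /(congr1 (fun k : nat => k%:R : R)) <-; last by lia.
rewrite !natrM; have ni0 := natr_fact_neq0 R (n - i).
by field; rewrite n0 ai0 ni0.
Qed.

Lemma Rpoly_neg (R : realType) (m alpha : nat) (M : 'M[R]_m) (l : 'I_m) t :
  (t < alpha)%N -> (m <= alpha)%N ->
  (Rpoly alpha M l).[- t.+1%:R] =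
  (alpha - m + l)`!%:R / (m - l.+1)`!%:R * pochhammer (- t%:R : R) (m - l.+1).
Proof.
move=> lt_ta le_ma; rewrite /Rpoly hornerD !hornerZ hornerM !horner_pochhammer.
have -> : ('X + 1 : {poly R}).[- t.+1%:R] = - t%:R.
  by rewrite !hornerE -natr1; ring.
rewrite [pochhammer _ alpha](@pochhammer_eq0 _ _ _ (Ordinal lt_ta)) ?addNr //.
rewrite mul0r mulr0 addr0; congr (_ / _ * _).
have -> : alpha%:R - m%:R + l.+1%:R = (alpha - m + l).+1%:R :> R.
  by rewrite -natrB // -natrD addnS.
exact: Gamma_natS.
Qed.

(** In [qdet] the Laguerre polynomials of negative index are replaced by 0, but
    the values of [Rpoly] at negative integers are not; this vanishing makes the
    two agree in the rows that matter for orthogonality. *)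
Lemma Rpoly_neg_eq0 (R : realType) (m alpha : nat) (M : 'M[R]_m) (l : 'I_m) t :
  (m <= alpha)%N -> (t < m - l.+1)%N -> (Rpoly alpha M l).[- t.+1%:R] = 0.
Proof.
move=> le_ma lt_t; rewrite Rpoly_neg //; last by lia.
by rewrite (@pochhammer_eq0 _ _ _ (Ordinal lt_t)) ?mulr0 ?addNr.
Qed.

Lemma Rpoly_neg_neq0 (R : realType) (m alpha : nat) (M : 'M[R]_m) (l : 'I_m) :
  (m <= alpha)%N -> (Rpoly alpha M l).[- (m - l)%:R] != 0.
Proof.
move=> le_ma; have lt_lm := ltn_ord l.
rewrite -[(m - l)%N]prednK ?subn_gt0 // Rpoly_neg //; last by lia.
rewrite !mulf_eq0 invr_eq0 !(negPf (natr_fact_neq0 _ _)) /=.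
rewrite -subnS; apply/prodf_neq0 => i _.
by rewrite addrC subr_eq0 eqr_nat neq_ltn ltn_ord.
Qed.

(** * Orthogonality *)

Lemma coef_jet0 (R : realType) (m : nat) (p : {poly R}) (i : 'I_m) :
  jet0 m p 0 i = p`_i * i`!%:R.
Proof.
by rewrite mxE horner_coef0 coef_derivn addn0 ffactnn mulr_natr.
Qed.

Lemma jet0_linear (R : realType) (m : nat) (a : R) (p q : {poly R}) :
  jet0 m (a *: p + q) = a *: jet0 m p + jet0 m q.
Proof.
apply/rowP => i; rewrite [RHS]mxE [X in _ = X + _]mxE !coef_jet0.
by rewrite coefD coefZ mulrDl mulrA.
Qed.

Lemma sobolev_linear_r (R : realType) (m alpha : nat) (M : 'M[R]_m)
    (p : {poly R}) (a : R) (q q' : {poly R}) :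
  sobolev_form alpha M p (a *: q + q') =
  a * sobolev_form alpha M p q + sobolev_form alpha M p q'.
Proof.
rewrite !sobolev_formE jet0_linear linearP mulmxDr -scalemxAr.
rewrite [X in _ + X = _]mxE [X in _ + (X + _) = _]mxE.
rewrite mulrDr mulrDl -scalerAr -scalerAl momentD momentZ; ring.
Qed.

Lemma sobolev_linear_l (R : realType) (m alpha : nat) (M : 'M[R]_m)
    (q : {poly R}) (a : R) (p p' : {poly R}) :
  sobolev_form alpha M (a *: p + p') q =
  a * sobolev_form alpha M p q + sobolev_form alpha M p' q.
Proof.
rewrite !sobolev_formE jet0_linear !mulmxDl -!scalemxAl.
rewrite [X in _ + X = _]mxE [X in _ + (X + _) = _]mxE.
rewrite !mulrDl -!scalerAl momentD momentZ; ring.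
Qed.

(** Why [Rpoly] enters the determinants: its row lists these pairings. *)
Lemma sobolev_Xn_small (R : realType) (m alpha : nat) (M : 'M[R]_m)
    (l : 'I_m) k :
  (m <= alpha)%N ->
  sobolev_form alpha M 'X^l (laguerre R alpha k) = (Rpoly alpha M l).[k%:R].
Proof.
move=> le_ma; have lt_lm := ltn_ord l.
rewrite sobolev_formE Rpoly_nat //; congr (_ + _).
  rewrite mulrAC -exprD moment_Xn_laguerre [(l + _)%N]addnC; congr (_ * _).
  have -> : (k + alpha = (alpha - m + l) + (k + (m - l.+1)).+1)%N by lia.
  exact: altbin_lt.
rewrite mxE mulr_sumr; apply: eq_bigr => i _.
rewrite mxE (bigD1 l) //= big1 ?addr0; last first.
  move=> j /eqP ne_jl; rewrite coef_jet0 coefXn; case: eqP; last by rewrite !mul0r.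
  by move/val_inj.
rewrite [X in _ * X]mxE !coef_jet0 coefXn eqxx mul1r coef_laguerre -!mulrA.
congr (_ * (_ * _)); case: leqP => _; last by rewrite mul0r.
by rewrite -!mulrA mulVf ?mulr1 ?natr_fact_neq0.
Qed.

Lemma sobolev_Xn_large (R : realType) (m alpha : nat) (M : 'M[R]_m) s k :
  (m <= s)%N -> (m <= alpha)%N ->
  sobolev_form alpha M 'X^s (laguerre R alpha k) =
  (alpha + (s - m))`!%:R * altbin R k (k + alpha) (alpha + (s - m)).
Proof.
move=> le_ms le_ma; rewrite sobolev_formE.
have -> : jet0 m ('X^s : {poly R}) = 0.
  apply/rowP => i; rewrite coef_jet0 coefXn mxE ltn_eqF ?mul0r //.
  exact: leq_trans (ltn_ord i) le_ms.
rewrite !mul0mx mxE addr0 mulrAC -exprD moment_Xn_laguerre.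
by have -> : (s + (alpha - m) = alpha + (s - m))%N by lia.
Qed.

Lemma sobolev_Xn_qdet (R : realType) (m alpha : nat) (M : 'M[R]_m) s n :
  sobolev_form alpha M 'X^s (qdet alpha M n) =
  \sum_(j < m.+1) casorati_weight (Rpoly alpha M) n%:R j *
    (if (j <= n)%N then sobolev_form alpha M 'X^s (laguerre R alpha (n - j))
     else 0).
Proof.
have B0 : sobolev_form alpha M 'X^s 0 = 0.
  have := @sobolev_linear_r _ _ alpha M 'X^s (-1) 0 0.
  by rewrite scaler0 addr0 mulN1r addNr.
rewrite qdetE.
elim: (index_enum _) => [|j t IHt]; first by rewrite !big_nil.
rewrite !big_cons sobolev_linear_r IHt; congr (_ * _ + _).
by case: ifP.
Qed.

(** For [s < m] the pairing replaces the top row of the determinant by a copy of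
    one of the rows below it; for [s >= m] the form is the Laguerre weight with
    [s - m] in place of [s], and each term vanishes. *)
Lemma sobolev_Xn_qdet_eq0 (R : realType) (m alpha : nat) (M : 'M[R]_m) s n :
  (m <= alpha)%N -> (s < n)%N -> sobolev_form alpha M 'X^s (qdet alpha M n) = 0.
Proof.
move=> le_ma lt_sn; rewrite sobolev_Xn_qdet.
have [lt_sm | le_ms] := ltnP s m.
  rewrite -[RHS](casorati_weight_orth (Rpoly alpha M) n%:R (Ordinal lt_sm)).
  apply: eq_bigr => j _; rewrite mulrC; congr (_ * _).
  case: leqP => [le_jn | lt_nj].
    by rewrite (@sobolev_Xn_small _ _ _ _ (Ordinal lt_sm)) // natrB.
  have lt_jm := ltn_ord j.
  have -> : n%:R - j%:R = - (j - n.+1).+1%:R :> R.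
    by rewrite -natr1 natrB // -natr1; ring.
  by rewrite Rpoly_neg_eq0 //=; lia.
rewrite big1 // => j _; have lt_jm := ltn_ord j.
case: leqP => [le_jn | _]; last by rewrite mulr0.
rewrite sobolev_Xn_large //.
have -> : (n - j + alpha =
  (alpha + (s - m)) + (n - j - (s - m)).-1.+1)%N by lia.
by rewrite altbin_lt bin_small ?mulr0 //; lia.
Qed.

(** Here the cancellation leaves exactly one term, that of the last column, whose
    cofactor is the determinant [Omega] at [n + 1]. *)
Lemma sobolev_Xn_qdet_diag (R : realType) (m alpha : nat) (M : 'M[R]_m) n :
  (m <= alpha)%N ->
  exists2 c : R, c != 0 &
    sobolev_form alpha M 'X^n (qdet alpha M n) =
    c * (Omega alpha M).[n%:R + 1].
Proof.
move=> le_ma; rewrite sobolev_Xn_qdet.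
have [lt_nm | le_mn] := ltnP n m.
  exists (- ((-1) ^+ m * (Rpoly alpha M (Ordinal lt_nm)).[- (m - n)%:R])).
    by rewrite oppr_eq0 mulf_eq0 signr_eq0 /= Rpoly_neg_neq0.
  have := casorati_weight_orth (Rpoly alpha M) n%:R (Ordinal lt_nm).
  rewrite big_ord_recr /= casorati_weight_max -Omega_casorati.
  have -> : n%:R - m%:R = - (m - n)%:R :> R by rewrite natrB ?(ltnW lt_nm); ring.
  move=> /eqP; rewrite addr_eq0 => /eqP E.
  rewrite big_ord_recr /= leqNgt lt_nm mulr0 addr0 mulNr -mulrA mulrCA -E.
  apply: eq_bigr => j _; rewrite mulrC; congr (_ * _).
  case: leqP => [le_jn | lt_nj].
    by rewrite (@sobolev_Xn_small _ _ _ _ (Ordinal lt_nm)) // natrB.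
  have lt_jm := ltn_ord j.
  have -> : n%:R - j%:R = - (j - n.+1).+1%:R :> R.
    by rewrite -natr1 natrB // -natr1; ring.
  by rewrite Rpoly_neg_eq0 //=; lia.
exists ((-1) ^+ m * ((alpha + (n - m))`!%:R * (-1) ^+ (n - m))).
  by rewrite !mulf_eq0 !signr_eq0 (negPf (natr_fact_neq0 _ _)).
rewrite big_ord_recr /= big1 => [|j _]; last first.
  have lt_jm := ltn_ord j.
  rewrite ifT; last by lia.
  rewrite sobolev_Xn_large //.
  have -> : (n - j + alpha =
    (alpha + (n - m)) + (n - j - (n - m)).-1.+1)%N by lia.
  by rewrite altbin_lt bin_small ?mulr0 //; lia.
rewrite add0r le_mn sobolev_Xn_large // [(n - m + _)%N]addnC altbin_eq.
rewrite casorati_weight_max -Omega_casorati; ring.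
Qed.

Lemma size_qdet_leq (R : realType) (m alpha : nat) (M : 'M[R]_m) n :
  (size (qdet alpha M n) <= n.+1)%N.
Proof.
rewrite qdetE; apply: leq_trans (size_sum _ _ _) _.
apply/bigmax_leqP => j _; apply: leq_trans (size_scale_leq _ _) _.
case: (leqP j n) => _; last by rewrite size_poly0.
by rewrite size_laguerre ltnS leq_subr.
Qed.

Lemma coef_qdet (R : realType) (m alpha : nat) (M : 'M[R]_m) n :
  (qdet alpha M n)`_n = (Omega alpha M).[n%:R] * ((-1) ^+ n / n`!%:R).
Proof.
rewrite qdetE coef_sum (bigD1 ord0) //= big1 => [|j ne_j0].
  rewrite addr0 coefZ casorati_weight0 -Omega_casorati subn0 coef_laguerre leqnn.
  by rewrite subnn bin0 mulr1.
rewrite coefZ; case: (leqP j n) => [le_jn|_]; last by rewrite coef0 mulr0.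
rewrite nth_default ?mulr0 // size_laguerre.
have : (0 < j)%N by rewrite lt0n.
by lia.
Qed.

Lemma Omega0_neq0 (R : realType) (m alpha : nat) (M : 'M[R]_m) :
  (m <= alpha)%N -> (Omega alpha M).[0] != 0.
Proof.
move=> le_ma; rewrite Omega_casorati horner_det horner_casorati.
apply/negP => /det0P[v /negP v0 vA0]; apply: v0; apply/eqP/rowP => l.
rewrite [RHS]mxE.
(* The matrix is lower antitriangular: its column k only meets the rows from
   m - 1 - k on, so the coordinates of v vanish one by one from the last. *)
suff: forall d (l : 'I_m), (m - l.+1)%N = d -> v 0 l = 0 by apply.
elim/ltn_ind => d IHd {}l def_d; have lt_lm := ltn_ord l.
have lt_dm : (d < m)%N by lia.
have /rowP/(_ (Ordinal lt_dm)) := vA0; rewrite !mxE (bigD1 l) //= big1.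
  rewrite addr0 !mxE sub0r (_ : d.+1 = (m - l)%N); last by lia.
  move=> /eqP; rewrite mulf_eq0 (negPf (Rpoly_neg_neq0 _ _ _)) // orbF.
  by move/eqP.
move=> i ne_il; have lt_im := ltn_ord i.
have ne : (i : nat) <> l by move=> /val_inj/eqP; rewrite (negPf ne_il).
rewrite mxE sub0r; have [lt_li | le_il] := ltnP l i.
  by rewrite (IHd (m - i.+1)%N) ?mul0r //; lia.
by rewrite Rpoly_neg_eq0 ?mulr0 //=; lia.
Qed.

Lemma poly_widen (R : nzRingType) (g : {poly R}) n :
  (size g <= n)%N -> g = \sum_(i < n) g`_i *: 'X^i.
Proof.
move=> sg; rewrite -poly_def; apply/polyP => i; rewrite coef_poly.
by case: ltnP => // le_ni; rewrite nth_default // (leq_trans sg).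
Qed.

(** ** Left and right orthogonal sequences of a bilinear form *)

Lemma size_sub_lead (R : fieldType) (f q : {poly R}) n :
  (size f <= n.+1)%N -> size q = n.+1 ->
  (size (f - (f`_n / q`_n) *: q)%R <= n)%N.
Proof.
move=> le_fn sq; apply/leq_sizeP => j le_nj.
have q0 : q`_n != 0.
  by rewrite -[n]/(n.+1.-1) -sq -lead_coefE lead_coef_eq0 -size_poly_gt0 sq.
rewrite coefB coefZ; case: (ltngtP n j) le_nj => // [lt_nj | <-] _.
  rewrite (nth_default _ (leq_trans le_fn lt_nj)) [q`_j]nth_default ?sq //.
  by rewrite mulr0 subr0.
by rewrite divfK // subrr.
Qed.

(** Expanding [g] in the triangular basis [p], the top coefficient is detected by
    pairing with [p k] itself, since the lower ones pair to 0 with it. *)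
Lemma left_orthogonal_nondegenerate (R : realType)
    (B : {poly R} -> {poly R} -> R)
    (B_r : forall p (a : R) (q q' : {poly R}), B p (a *: q + q') = a * B p q + B p q')
    (p : nat -> {poly R}) (k : nat) (g : {poly R}) :
  left_orthogonal B p -> (size g <= k)%N ->
  (forall j, (j < k)%N -> B (p j) g = 0) -> g = 0.
Proof.
move=> Bp; elim: k => [|k IHk] sg Bg.
  by apply/eqP; rewrite -size_poly_leq0.
have [sp Bp0 Bpp] := Bp k.
have := size_sub_lead sg sp; set c := _ / _; set h := _ - _ => sh.
have gE : g = c *: p k + h by rewrite addrC subrK.
have c0 : c = 0.
  have := Bg k (ltnSn k); rewrite gE B_r (Bp0 h sh) addr0 => /eqP.
  by rewrite mulf_eq0 (negPf Bpp) orbF => /eqP.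
apply: IHk => [|j lt_jk]; first by rewrite gE c0 scale0r add0r.
by apply: Bg; apply: ltnW.
Qed.

(** Both kinds of orthogonal sequences amount to the nondegeneracy of the form on
    polynomials of degree at most [n], for every [n]. *)
Lemma right_to_left_orthogonal (R : realType)
    (B : {poly R} -> {poly R} -> R)
    (B_r : forall p (a : R) (q q' : {poly R}), B p (a *: q + q') = a * B p q + B p q')
    (B_l : forall q (a : R) (p p' : {poly R}), B (a *: p + p') q = a * B p q + B p' q)
    (q : nat -> {poly R}) :
  left_orthogonal (fun f g => B g f) q -> exists p, left_orthogonal B p.
Proof.
move=> Bq.
have B0r p : B p 0 = 0.
  by have := B_r p (-1) 0 0; rewrite scaler0 addr0 mulN1r addNr.
have B0l p : B 0 p = 0.
  by have := B_l p (-1) 0 0; rewrite scaler0 addr0 mulN1r addNr.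
have Bsr p n (c : 'I_n -> R) (f : 'I_n -> {poly R}) :
    B p (\sum_i c i *: f i) = \sum_i c i * B p (f i).
  elim: (index_enum _) => [|j t IHt]; first by rewrite !big_nil.
  by rewrite !big_cons B_r IHt.
have Bsl p n (c : 'I_n -> R) (f : 'I_n -> {poly R}) :
    B (\sum_i c i *: f i) p = \sum_i c i * B (f i) p.
  elim: (index_enum _) => [|j t IHt]; first by rewrite !big_nil.
  by rewrite !big_cons B_l IHt.
suff ex n : exists p : {poly R}, [/\ size p = n.+1,
    forall g : {poly R}, (size g <= n)%N -> B p g = 0 & B p p != 0].
  by have [p pP] := choice ex; exists p.
(* n linear conditions on the n + 1 coefficients have a nonzero solution. *)
pose G : 'M[R]_(n.+1, n) := \matrix_(i, j) B 'X^i 'X^j.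
have /rowV0Pn[v /sub_kermxP vG v0] : kermx G != 0.
  by rewrite kermx_eq0 /row_free neq_ltn ltnS rank_leq_col.
pose p := \poly_(i < n.+1) v 0 (inord i).
have pE : p = \sum_(i < n.+1) v 0 i *: 'X^i.
  rewrite /p poly_def; apply: eq_bigr => i _.
  by rewrite (_ : inord i = i) //; apply: val_inj; rewrite /= inordK.
have p0 : p != 0.
  apply: contraNneq v0 => p0; apply/eqP/rowP => i; rewrite mxE.
  have /polyP/(_ i) := p0; rewrite coef0 coef_poly ltn_ord => <-.
  by congr (v 0 _); apply: val_inj; rewrite /= inordK.
have BpX (j : 'I_n) : B p 'X^j = 0.
  have /rowP/(_ j) := vG; rewrite !mxE pE Bsl => E; rewrite -[RHS]E.
  by apply: eq_bigr => i _; rewrite mxE.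
have Bp (g : {poly R}) : (size g <= n)%N -> B p g = 0.
  move=> sg; rewrite (poly_widen sg) Bsr big1 // => i _.
  by rewrite BpX mulr0.
have sp0 : (0 < size p)%N by rewrite size_poly_gt0.
have sp : (size p <= n.+1)%N by exact: size_poly.
pose k := (size p).-1; have size_p : size p = k.+1 by rewrite prednK.
have [sq Bq0 Bqq] := Bq k.
have := size_sub_lead (eq_leq size_p) sq; set c := _ / _; set h := _ - _ => sh.
have pE' : p = c *: q k + h by rewrite addrC subrK.
have Bpq : B p (q k) = c * B (q k) (q k).
  by rewrite {1}pE' B_l (Bq0 h sh) addr0.
have c0 : c != 0.
  apply: contraTneq sh => c0; rewrite -ltnNge /h c0 scale0r subr0 size_p.
  exact: ltnSn.
have def_n : k = n.
  have [lt_kn | ] := ltnP k n; last by lia.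
  by have := Bp (q k); rewrite sq Bpq => /(_ lt_kn)/eqP; rewrite mulf_eq0
    (negPf c0) (negPf Bqq).
exists p; split; [by rewrite size_p def_n | exact: Bp |].
have -> : B p p = c * (c * B (q k) (q k)).
  by rewrite {2}pE' B_r Bpq (Bp h) ?addr0 // -def_n.
by do 2 apply: mulf_neq0 => //.
Qed.

Lemma sobolev_qdet_eq0 (R : realType) (m alpha : nat) (M : 'M[R]_m) n (f : {poly R}) :
  (m <= alpha)%N -> (size f <= n)%N ->
  sobolev_form alpha M f (qdet alpha M n) = 0.
Proof.
move=> le_ma sf; rewrite (poly_widen sf).
have B0 : sobolev_form alpha M 0 (qdet alpha M n) = 0.
  have := @sobolev_linear_l _ _ alpha M (qdet alpha M n) (-1) 0 0.
  by rewrite scaler0 addr0 mulN1r addNr.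
elim: (index_enum _) => [|j t IHt]; first by rewrite big_nil.
by rewrite big_cons sobolev_linear_l IHt sobolev_Xn_qdet_eq0 // mulr0 addr0.
Qed.

Lemma size_qdet (R : realType) (m alpha : nat) (M : 'M[R]_m) n :
  (Omega alpha M).[n%:R] != 0 -> size (qdet alpha M n) = n.+1.
Proof.
move=> On; apply/eqP; rewrite eqn_leq size_qdet_leq /= ltnNge.
apply: contraNN On => /leq_sizeP/(_ n (leqnn n))/eqP.
rewrite coef_qdet !mulf_eq0 signr_eq0 invr_eq0.
by rewrite (negPf (natr_fact_neq0 _ _)) !orbF.
Qed.

Lemma qdet_orthogonal (R : realType) (m alpha : nat) (M : 'M[R]_m) :
  (m <= alpha)%N -> (forall n : nat, (Omega alpha M).[n%:R] != 0) ->
  left_orthogonal (fun f g => sobolev_form alpha M g f) (qdet alpha M).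
Proof.
move=> le_ma O0 n; have sq := size_qdet (O0 n); split => //.
  by move=> p sp; exact: sobolev_qdet_eq0.
have := size_sub_lead (eq_leq sq) (size_polyXn R n).
rewrite coefXn eqxx divr1; set c := _`_n; set h := _ - _ => sh.
have qE : qdet alpha M n = c *: 'X^n + h by rewrite addrC subrK.
have [b b0 bE] := sobolev_Xn_qdet_diag M n le_ma.
rewrite {1}qE sobolev_linear_l (sobolev_qdet_eq0 _ _ sh) // addr0 bE natr1.
rewrite !mulf_neq0 // /c -[n]/(n.+1.-1) -{2}sq -lead_coefE lead_coef_eq0.
by rewrite -size_poly_gt0 sq.
Qed.

(** By induction on n: if Omega vanishes first at n + 1, then the polynomial of
    index n has exact degree n and is orthogonal to all polynomials of degree at
    most n, which contradicts the existence of orthogonal polynomials. *)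
Lemma Omega_nat_neq0 (R : realType) (m alpha : nat) (M : 'M[R]_m)
    (p : nat -> {poly R}) :
  (m <= alpha)%N -> left_orthogonal (sobolev_form alpha M) p ->
  forall n : nat, (Omega alpha M).[n%:R] != 0.
Proof.
move=> le_ma Bp; elim=> [|n IHn]; first exact: Omega0_neq0.
apply/negP => /eqP On; have sq := size_qdet IHn.
have q0 : qdet alpha M n = 0.
  apply: (left_orthogonal_nondegenerate (sobolev_linear_r alpha M) Bp
            (eq_leq sq)).
  move=> j lt_jn; have [sp _ _] := Bp j.
  have le_pn : (size (p j) <= n.+1)%N by rewrite sp.
  have := size_sub_lead le_pn (size_polyXn R n).
  rewrite coefXn eqxx divr1; set c := _`_n; set h := _ - _ => sh.
  have -> : p j = c *: 'X^n + h by rewrite addrC subrK.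
  rewrite sobolev_linear_l (sobolev_qdet_eq0 _ _ sh) // addr0.
  have [b _ ->] := sobolev_Xn_qdet_diag M n le_ma.
  by rewrite natr1 On !mulr0.
by move: sq; rewrite q0 size_poly0.
Qed.

(** * The operator [DS] acts diagonally on the determinantal polynomials *)

Definition krallM (R : realType) (m : nat) (r : 'I_m -> {poly R})
    (S : {poly R}) (h : 'I_m) : {poly R} :=
  \sum_(j < m) shiftp (S * (\adj (casorati r)) j h) j.+1%:R.

Lemma shiftpM (R : realType) (c : R) (p q : {poly R}) :
  shiftp (p * q) c = shiftp p c * shiftp q c.
Proof. by rewrite /shiftp comp_polyM. Qed.

Lemma shiftp_sign (R : realType) (c : R) n :
  shiftp ((-1) ^+ n) c = (-1) ^+ n.
Proof. exact: (rmorph_sign (comp_poly ('X + c%:P))). Qed.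

Lemma shiftp_shiftp (R : realType) (b c : R) (p : {poly R}) :
  shiftp (shiftp p b) c = shiftp p (b + c).
Proof.
rewrite /shiftp -comp_polyA; congr (_ \Po _).
by rewrite comp_polyD comp_polyX comp_polyC -addrA -polyCD [c + b]addrC.
Qed.

Lemma MpolyE (R : realType) (m alpha : nat) (M : 'M[R]_m) (S : {poly R})
    (h : 'I_m) : Mpoly alpha M S h = krallM (Rpoly alpha M) S h.
Proof.
apply: eq_bigr => j _; rewrite shiftpM mxE shiftpM shiftp_sign.
rewrite [_ * shiftp S _]mulrC -mulrA; congr (_ * (_ * _)).
rewrite -[RHS](det_map_mx (comp_poly ('X + (j.+1%:R)%:P))); congr (\det _).
apply/matrixP => a b; rewrite !mxE.
transitivity (shiftp (shiftp (Rpoly alpha M (lift h a)) (- (lift j b).+1%:R))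
  j.+1%:R); last by [].
by rewrite shiftp_shiftp; congr shiftp; rewrite -!natr1; ring.
Qed.

Definition casorati_weight_nat (R : realType) (m : nat) (r : 'I_m -> {poly R})
    (x : R) (i : nat) : R :=
  if (i <= m)%N then casorati_weight r x (inord i) else 0.

Lemma sum_casorati_weight_nat (R : realType) (m : nat) (r : 'I_m -> {poly R})
    (x : R) (n : nat) (F : nat -> R) : (m < n)%N ->
  \sum_(i < n) casorati_weight_nat r x i * F i =
  \sum_(i < m.+1) casorati_weight r x i * F i.
Proof.
move=> lt_mn; rewrite [RHS](_ : _ =
    \sum_(i < m.+1) casorati_weight_nat r x i * F i).
  rewrite [RHS](big_ord_widen n (fun i => casorati_weight_nat r x i * F i)) //.
  rewrite [RHS]big_mkcond; apply: eq_bigr => i _.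
  by rewrite /casorati_weight_nat ltnS; case: leqP => //; rewrite mul0r.
apply: eq_bigr => i _; rewrite /casorati_weight_nat -ltnS ltn_ord.
by rewrite inord_val.
Qed.

(** The vector of adjugate entries is dual to the window of [m] consecutive
    points below [y]. *)
Lemma adj_casorati_dual (R : realType) (m : nat) (r : 'I_m -> {poly R})
    (y : R) (j : 'I_m) (k : nat) : (k < m)%N ->
  \sum_h ((\adj (casorati r)) j h).[y] * (r h).[y - k.+1%:R] =
  (\det (casorati r)).[y] *+ (val j == k).
Proof.
move=> lt_km; have /matrixP/(_ j (Ordinal lt_km)) := mul_adj_mx (casorati r).
rewrite !mxE => /(congr1 (horner^~ y)); rewrite horner_sum hornerMn => <-.
by apply: eq_bigr => h _; rewrite hornerM; congr (_ * _); rewrite mxE horner_shiftp.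
Qed.

Lemma horner_krallM (R : realType) (m : nat) (r : 'I_m -> {poly R})
    (S : {poly R}) (h : 'I_m) (x : R) :
  (krallM r S h).[x] = \sum_(j < m)
    S.[x + j.+1%:R] * ((\adj (casorati r)) j h).[x + j.+1%:R].
Proof.
rewrite /krallM horner_sum; apply: eq_bigr => j _.
by rewrite horner_shiftp hornerM.
Qed.

Lemma telescope_nabla (R : realType) (P Q : {poly R}) (x : R) (u : nat) :
  P - shiftp P (-1) = Q ->
  \sum_(j < u) Q.[x + j.+1%:R] = P.[x + u%:R] - P.[x].
Proof.
move=> <-; elim: u => [|u IHu]; first by rewrite big_ord0 addr0 subrr.
rewrite big_ord_recr /= IHu hornerD hornerN horner_shiftp -natr1.
by rewrite (_ : x + (u%:R + 1) - 1 = x + u%:R); ring.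
Qed.

(** Fix a shift [j].  The sum over all [i] of the weights against the [j]-th
    dual vector vanishes; the dual vector itself kills all but few of the terms.
    If [j < u], exactly the term [i = u] survives among those with [u <= i];
    if [u <= j], all terms with [i < u] vanish. *)
Lemma weight_dual_sum (R : realType) (m : nat) (r : 'I_m -> {poly R})
    (x : R) (u : nat) (j : 'I_m) :
  let y := x - u%:R + j.+1%:R in
  \sum_(i < u) casorati_weight_nat r x i *
     (\sum_h ((\adj (casorati r)) j h).[y] * (r h).[x - i%:R]) =
  - ((casorati_weight_nat r x u * (\det (casorati r)).[y]) *+ (j < u)%N).
Proof.
move=> y; pose D i := \sum_h ((\adj (casorati r)) j h).[y] * (r h).[x - i%:R].
have lt_jm := ltn_ord j.
have Dwin (i : nat) : (u <= i + j)%N -> (i + j < m + u)%N ->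
    D i = (\det (casorati r)).[y] *+ (i == u).
  move=> h1 h2; have lt_m : (i + j - u < m)%N by lia.
  have -> : (i == u) = (val j == i + j - u)%N.
    by apply/eqP/eqP => /= ?; lia.
  rewrite -(adj_casorati_dual r y j lt_m); apply: eq_bigr => h _.
  congr (_ * _.[_]); rewrite /y -!natr1 natrB // natrD; ring.
have Dtot n : (m < n)%N -> \sum_(i < n) casorati_weight_nat r x i * D i = 0.
  move=> lt_mn; rewrite sum_casorati_weight_nat // /D.
  under eq_bigr do rewrite mulr_sumr.
  rewrite exchange_big big1 // => h _.
  transitivity (((\adj (casorati r)) j h).[y] *
    (\sum_(i < m.+1) (r h).[x - i%:R] * casorati_weight r x i)).
    by rewrite mulr_sumr; apply: eq_bigr => i _; ring.
  by rewrite casorati_weight_orth mulr0.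
case: ltnP => [lt_ju | le_uj]; last first.
  rewrite mulr0n oppr0 big1 // => i _; have lt_iu := ltn_ord i.
  rewrite -/(D i) Dwin; [|lia..].
  by rewrite ltn_eqF // mulr0.
have tail : \sum_(u.+1 <= i < m + u.+1) casorati_weight_nat r x i * D i = 0.
  rewrite big_nat_cond big1 // => i; rewrite andbT => /andP[lt_ui _].
  have [le_im | lt_mi] := leqP i m.
    rewrite Dwin; [|lia..].
    by rewrite gtn_eqF // mulr0.
  by rewrite /casorati_weight_nat leqNgt lt_mi mul0r.
have lt_mn : (m < m + u.+1)%N by lia.
have := Dtot _ lt_mn.
rewrite -(big_mkord xpredT (fun i => casorati_weight_nat r x i * D i)).
rewrite (@big_cat_nat _ _ _ u) //=; last by lia.
rewrite big_mkord [X in _ + X]big_ltn; last by lia.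
rewrite tail addr0 Dwin ?leq_addr //; last by lia.
by rewrite eqxx mulr1n => /eqP; rewrite addr_eq0 => /eqP.
Qed.

(** The eigenvalue equation of [DS] for one coefficient in the Laguerre basis.  The
    sum over the shifts [j] on the right of [horner_krallM] reduces by
    [weight_dual_sum] to the values of [S * det] at the [u] points from
    [x - u + 1] to [x], which telescope to a difference of values of [P]. *)
Lemma casorati_weight_eigen (R : realType) (m : nat) (r : 'I_m -> {poly R})
    (S P : {poly R}) (x : R) (u : nat) :
  P - shiftp P (-1) = S * \det (casorati r) ->
  \sum_(i < u) casorati_weight_nat r x i *
    (\sum_h (r h).[x - i%:R] * (krallM r S h).[x - u%:R]) =
  casorati_weight_nat r x u * (P.[x - u%:R] - P.[x]).
Proof.
move=> dP; pose y (j : 'I_m) := x - u%:R + j.+1%:R.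
transitivity (\sum_(j < m) S.[y j] * (\sum_(i < u) casorati_weight_nat r x i *
    (\sum_h ((\adj (casorati r)) j h).[y j] * (r h).[x - i%:R]))).
  under [RHS]eq_bigr do rewrite mulr_sumr.
  rewrite exchange_big /=; apply: eq_bigr => i _.
  under [RHS]eq_bigr do rewrite mulrCA mulr_sumr.
  rewrite -mulr_sumr exchange_big /=; congr (_ * _).
  apply: eq_bigr => h _; rewrite horner_krallM mulr_sumr.
  by apply: eq_bigr => j _; rewrite -/(y j); ring.
under eq_bigr do rewrite weight_dual_sum -/(y _).
rewrite /casorati_weight_nat; case: leqP => [le_um | _]; last first.
  by rewrite mul0r big1 // => j _; rewrite mul0r mul0rn oppr0 mulr0.
have := telescope_nabla (x - u%:R) u dP; rewrite subrK => tel.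
rewrite -opprB -tel mulrN mulr_sumr.
rewrite (big_ord_widen m (fun j => casorati_weight r x (inord u) *
  (S * \det (casorati r)).[x - u%:R + j.+1%:R])) // [in RHS]big_mkcond -sumrN.
apply: eq_bigr => j _; rewrite -/(y j); case: ifP => _; last first.
  by rewrite mulr0n oppr0 mulr0.
by rewrite mulr1n hornerM; ring.
Qed.

(** * Polynomials in a linear operator *)

Lemma Dalpha_linear (R : realType) (a : nat) (c : R) (f g : {poly R}) :
  Dalpha a (c *: f + g) = c *: Dalpha a f + Dalpha a g.
Proof.
apply/polyP => i.
rewrite [RHS]coefD [in RHS]coefZ !coef_Dalpha !coefD !coefZ; ring.
Qed.

Lemma linear_op0 (R : realType) (T : {poly R} -> {poly R}) :
  (forall (c : R) (f g : {poly R}), T (c *: f + g) = c *: T f + T g) -> T 0 = 0.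
Proof.
by move=> T_lin; have := T_lin (-1) 0 0; rewrite scaler0 addr0 scaleN1r addNr.
Qed.

Lemma linear_op_sum (R : realType) (T : {poly R} -> {poly R}) (I : Type)
    (r : seq I) (c : I -> R) (f : I -> {poly R}) :
  (forall (c : R) (f g : {poly R}), T (c *: f + g) = c *: T f + T g) ->
  T (\sum_(i <- r) c i *: f i) = \sum_(i <- r) c i *: T (f i).
Proof.
move=> T_lin; elim: r => [|i r IHr]; first by rewrite !big_nil linear_op0.
by rewrite !big_cons T_lin IHr.
Qed.

Lemma iter_linear (R : realType) (T : {poly R} -> {poly R}) n :
  (forall (c : R) (f g : {poly R}), T (c *: f + g) = c *: T f + T g) ->
  forall (c : R) (f g : {poly R}),
    iter n T (c *: f + g) = c *: iter n T f + iter n T g.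
Proof. by move=> T_lin c f g; elim: n => //= n ->. Qed.

Lemma poly_op_linear (R : realType) (P : {poly R}) (T : {poly R} -> {poly R}) :
  (forall (c : R) (f g : {poly R}), T (c *: f + g) = c *: T f + T g) ->
  forall (c : R) (f g : {poly R}),
    poly_op P T (c *: f + g) = c *: poly_op P T f + poly_op P T g.
Proof.
move=> T_lin c f g; rewrite /poly_op scaler_sumr -big_split /=.
apply: eq_bigr => i _; rewrite iter_linear // scalerDr !scalerA.
by rewrite mulrC.
Qed.

Lemma poly_op_widen (R : realType) (P : {poly R}) (T : {poly R} -> {poly R})
    (f : {poly R}) n :
  (size P <= n)%N -> poly_op P T f = \sum_(i < n) P`_i *: iter i T f.
Proof.
move=> sP; rewrite /poly_op.
rewrite (big_ord_widen n (fun i => P`_i *: iter i T f)) // big_mkcond.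
apply: eq_bigr => i _; case: ltnP => // le_Pi.
by rewrite nth_default ?scale0r.
Qed.

Lemma poly_op_eigen (R : realType) (P : {poly R}) (T : {poly R} -> {poly R})
    (f : {poly R}) (c : R) :
  (forall (c : R) (f g : {poly R}), T (c *: f + g) = c *: T f + T g) ->
  T f = c *: f -> poly_op P T f = P.[c] *: f.
Proof.
move=> T_lin Tf; rewrite /poly_op horner_coef scaler_suml.
apply: eq_bigr => i _; rewrite -scalerA; congr (_ *: _).
elim: (nat_of_ord i) => [|n IHn] /=; first by rewrite expr0 scale1r.
have := iter_linear 1 T_lin (c ^+ n) f 0; rewrite /= !addr0 IHn => ->.
by rewrite linear_op0 // addr0 Tf scalerA exprSr.
Qed.

Lemma DS_linear (R : realType) (m alpha : nat) (M : 'M[R]_m) (S P : {poly R})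
    (c : R) (f g : {poly R}) :
  DS alpha M S P (c *: f + g) = c *: DS alpha M S P f + DS alpha M S P g.
Proof.
have D_lin := @Dalpha_linear R alpha.
rewrite /DS poly_op_linear // scalerDr -!addrA; congr (_ + _).
rewrite [in RHS]addrCA; congr (_ + _).
rewrite scaler_sumr -big_split; apply: eq_bigr => h _ /=.
by rewrite (poly_op_linear _ D_lin) derivD derivZ (poly_op_linear _ D_lin).
Qed.

Lemma DS_laguerre (R : realType) (m alpha : nat) (M : 'M[R]_m) (S P : {poly R})
    (k : nat) :
  let r := Rpoly alpha M in
  DS alpha M S P (laguerre R alpha k) =
  P.[k%:R] *: laguerre R alpha k -
  \sum_(t < k) (\sum_h (r h).[k%:R] * (krallM r S h).[t%:R])
    *: laguerre R alpha t.
Proof.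
move=> r; have D_lin := @Dalpha_linear R alpha.
have D_eig n := Dalpha_laguerre R alpha n.
rewrite /DS (poly_op_eigen _ D_lin (D_eig k)); congr (_ + _).
under [X in _ = - X]eq_bigr do rewrite scaler_suml.
rewrite exchange_big -sumrN; apply: eq_bigr => h _ /=.
rewrite (poly_op_eigen _ D_lin (D_eig k)) derivZ laguerre_deriv MpolyE.
rewrite -sumrN scaler_sumr -sumrN.
rewrite (_ : \sum_(i < k) _ = \sum_(i < k)
  - (r h).[k%:R] *: laguerre R alpha i); last first.
  by apply: eq_bigr => i _; rewrite scalerN scaleNr.
rewrite (linear_op_sum _ _ _ (poly_op_linear _ D_lin)).
apply: eq_bigr => t _; rewrite (poly_op_eigen _ D_lin (D_eig t)).
by rewrite scalerA mulNr scaleNr.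
Qed.

Lemma qdet_laguerre_sum (R : realType) (m alpha : nat) (M : 'M[R]_m) n :
  qdet alpha M n = \sum_(i < n.+1)
    casorati_weight_nat (Rpoly alpha M) n%:R i *: laguerre R alpha (n - i).
Proof.
pose r := Rpoly alpha M; pose N := maxn n m.
pose F i := casorati_weight_nat r n%:R i *:
  (if (i <= n)%N then laguerre R alpha (n - i) else 0).
transitivity (\sum_(i < N.+1) F i).
  rewrite qdetE (_ : \sum_(j < m.+1) _ = \sum_(j < m.+1) F j).
    rewrite (@big_ord_widen _ _ _ m.+1 N.+1) ?ltnS ?leq_maxr // big_mkcond.
    apply: eq_bigr => i _; rewrite /F /casorati_weight_nat ltnS.
    by case: (leqP i m) => // _; rewrite scale0r.
  apply: eq_bigr => i _.
  by rewrite /F /casorati_weight_nat -(ltnS i m) ltn_ord inord_val.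
rewrite [RHS](_ : _ = \sum_(j < n.+1) F j).
  rewrite [RHS](@big_ord_widen _ _ _ n.+1 N.+1) ?ltnS ?leq_maxl //.
  rewrite [RHS]big_mkcond; apply: eq_bigr => i _; rewrite /F ltnS.
  by case: (leqP i n) => // _; rewrite scaler0.
by apply: eq_bigr => i _; rewrite /F -(ltnS i n) ltn_ord.
Qed.

Lemma sum_window_rev (V : nmodType) (F : nat -> V) (i n : nat) : (i <= n)%N ->
  \sum_(t < n - i) F t = \sum_(u < n.+1 | (i < u)%N) F (n - u)%N.
Proof.
move=> le_in; rewrite [RHS](reindex_inj rev_ord_inj) /=.
rewrite (@big_ord_widen _ _ _ (n - i) n.+1); last by lia.
apply: eq_big => [u | u _]; first by have := ltn_ord u; lia.
by congr F; have := ltn_ord u; lia.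
Qed.

(** Comparing the coefficients of each Laguerre polynomial reduces the claim to
    [casorati_weight_eigen]. *)
Lemma DS_qdet (R : realType) (m alpha : nat) (M : 'M[R]_m) (S P : {poly R})
    (n : nat) :
  P - shiftp P (-1) = S * Omega alpha M ->
  DS alpha M S P (qdet alpha M n) = P.[n%:R] *: qdet alpha M n.
Proof.
move=> dP; pose r := Rpoly alpha M; pose w := casorati_weight_nat r n%:R.
pose L k := laguerre R alpha k.
rewrite qdet_laguerre_sum -/r -/w (linear_op_sum _ _ _ (DS_linear alpha M S P)).
pose G i u := \sum_h (r h).[n%:R - i%:R] * (krallM r S h).[n%:R - u%:R].
transitivity (\sum_(i < n.+1) (w i * P.[n%:R - i%:R]) *: L (n - i)%N -
   \sum_(i < n.+1) \sum_(u < n.+1 | (i < u)%N) (w i * G i u) *: L (n - u)%N).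
  rewrite -sumrB; apply: eq_bigr => i _; have le_in : (i <= n)%N := ltn_ord i.
  rewrite DS_laguerre scalerBr scalerA natrB //; congr (_ - _).
  rewrite scaler_sumr.
  rewrite (sum_window_rev (fun t => w i *: ((\sum_h (r h).[n%:R - i%:R] *
    (krallM r S h).[t%:R]) *: L t)) le_in).
  apply: eq_bigr => u _; rewrite scalerA; congr (_ * _ *: _).
  by apply: eq_bigr => h _; rewrite natrB // -ltnS.
rewrite (exchange_big_dep xpredT) //= -sumrB scaler_sumr.
apply: eq_bigr => u _; have le_un : (u <= n)%N := ltn_ord u.
rewrite -scaler_suml -scalerBl scalerA; congr (_ *: _).
have := casorati_weight_eigen n%:R u dP.
rewrite (big_ord_widen n.+1 (fun i => w i * G i u)) ?leqW // => ->.
rewrite -/r -/w; ring.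
Qed.

(** * Differences and degrees *)

Definition fdiff (R : realType) (c : R) (p : {poly R}) : {poly R} :=
  p - shiftp p c.

Lemma shiftpD (R : realType) (c : R) (p q : {poly R}) :
  shiftp (p + q) c = shiftp p c + shiftp q c.
Proof. by rewrite /shiftp comp_polyD. Qed.

Lemma shiftpZ (R : realType) (c a : R) (p : {poly R}) :
  shiftp (a *: p) c = a *: shiftp p c.
Proof. by rewrite /shiftp comp_polyZ. Qed.

Lemma shiftp_sum (R : realType) (c : R) (I : Type) (s : seq I)
    (F : I -> {poly R}) :
  shiftp (\sum_(i <- s) F i) c = \sum_(i <- s) shiftp (F i) c.
Proof. exact: (raddf_sum (comp_poly ('X + c%:P))). Qed.

Lemma size_shiftp (R : realType) (c : R) (p : {poly R}) :
  size (shiftp p c) = size p.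
Proof. by rewrite size_comp_poly2 // size_XaddC. Qed.

Lemma shiftp0 (R : realType) (p : {poly R}) : shiftp p 0 = p.
Proof. by rewrite /shiftp addr0 comp_polyXr. Qed.

Lemma shiftp_MXaddC (R : realType) (c a : R) (p : {poly R}) :
  shiftp (p * 'X + a%:P) c = shiftp p c * 'X + c *: shiftp p c + a%:P.
Proof.
rewrite shiftpD shiftpM /shiftp comp_polyX comp_polyC mulrDr.
by rewrite [_ * c%:P]mulrC mul_polyC.
Qed.

Lemma coef_shiftp_top (R : realType) (c : R) (p : {poly R}) d :
  (size p <= d.+1)%N -> (shiftp p c)`_d = p`_d.
Proof.
elim/poly_ind: p d => [|p a IHp] d sp.
  by rewrite /shiftp comp_poly0.
rewrite shiftp_MXaddC !coefD coefZ !coefMX coefC.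
case: d sp => [|d] sp /=.
  have p0 : p = 0.
    apply/eqP; apply: contraTT sp => p0; rewrite size_MXaddC (negPf p0) andFb.
    by rewrite -ltnNge ltnS lt0n size_poly_eq0.
  by rewrite p0 /shiftp comp_poly0 coef0 mulr0 addr0.
have sp' : (size p <= d.+1)%N.
  move: sp; rewrite size_MXaddC; case: ifP => // /andP[/eqP-> _] _.
  by rewrite size_poly0.
by rewrite IHp // [(shiftp p c)`_d.+1]nth_default ?size_shiftp // mulr0 addr0.
Qed.

Lemma coef_shiftp_subtop (R : realType) (c : R) (p : {poly R}) d :
  (size p <= d.+2)%N -> (shiftp p c)`_d = p`_d + c * d.+1%:R * p`_d.+1.
Proof.
elim/poly_ind: p d => [|p a IHp] d sp.
  by rewrite /shiftp comp_poly0 !coef0 mulr0 addr0.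
have sp' : (size p <= d.+1)%N.
  move: sp; rewrite size_MXaddC; case: ifP => // /andP[/eqP-> _] _.
  by rewrite size_poly0.
rewrite shiftp_MXaddC !coefD coefZ !coefMX !coefC /=.
rewrite [(shiftp p c)`_d]coef_shiftp_top //.
case: d sp sp' => [|d] sp sp' /=; first by ring.
rewrite IHp // -[d.+2%:R]natr1; ring.
Qed.

Lemma fdiff_step (R : realType) (c : R) (p : {poly R}) d :
  (size p <= d.+1)%N ->
  (size (fdiff c p) <= d)%N /\
  (forall e, d = e.+1 -> (fdiff c p)`_e = - c * d%:R * p`_d).
Proof.
move=> sp; split.
  apply/leq_sizeP => j le_dj; rewrite coefB coef_shiftp_top ?subrr //.
  exact: leq_trans sp _.
move=> e de; rewrite coefB coef_shiftp_subtop -?de //.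
by ring.
Qed.

(** Multiplying the k-th difference by [X^k] restores the degree, so that no
    truncated subtraction is needed to record the leading coefficient. *)
Lemma iter_fdiff_lead (R : realType) (c : R) (p : {poly R}) d k :
  (size p <= d.+1)%N ->
  (size (iter k (fdiff c) p) <= d.+1 - k)%N /\
  (iter k (fdiff c) p * 'X^k)`_d = (- c) ^+ k * (d ^_ k)%:R * p`_d.
Proof.
move=> sp; elim: k => [|k [IHs IHc]].
  by rewrite subn0 expr0 mulr1 ffactn0 !mul1r.
rewrite iterS; set f := iter k (fdiff c) p in IHs IHc *.
have [le_kd | lt_dk] := leqP k d; last first.
  have f0 : fdiff c f = 0.
    have /eqP -> : f == 0 by rewrite -size_poly_leq0; lia.
    by rewrite /fdiff /shiftp comp_poly0 subrr.
  rewrite f0 size_poly0 mul0r coef0 ffact_small ?mulr0 ?mul0r //.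
  exact: ltnW.
have sf : (size f <= (d - k).+1)%N by lia.
have [sg cg] := fdiff_step c sf.
split; first by lia.
move: IHc; rewrite !coefMXn ltnNge le_kd /= => IHc.
have [lt_kd | le_dk] := ltnP k d; last first.
  have -> : d = k by lia.
  by rewrite ltnSn ffact_small // mulr0 mul0r.
have /cg -> : (d - k = (d - k.+1).+1)%N by lia.
rewrite ltnNge lt_kd /= IHc ffactnSr natrM exprS; ring.
Qed.

Lemma iter_fdiff_sum (R : realType) (c : R) (p : {poly R}) k n : (k < n)%N ->
  iter k (fdiff c) p =
  \sum_(j < n) ((-1) ^+ j * 'C(k, j)%:R) *: shiftp p (j%:R * c).
Proof.
move=> lt_kn; transitivity (\sum_(j < k.+1)
    ((-1) ^+ j * 'C(k, j)%:R) *: shiftp p (j%:R * c)); last first.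
  rewrite (big_ord_widen n (fun j => ((-1) ^+ j * 'C(k, j)%:R) *:
    shiftp p (j%:R * c))) // big_mkcond; apply: eq_bigr => j _.
  by rewrite ltnS; case: leqP => // lt_kj; rewrite bin_small // mulr0 scale0r.
elim: k {lt_kn n} => [|k IHk].
  by rewrite big_ord1 mul0r shiftp0 expr0 bin0 mulr1 scale1r.
rewrite iterS IHk {IHk} /fdiff [in RHS]big_ord_recl /=.
rewrite [X in X - _](_ : _ = \sum_(j < k.+2)
    ((-1) ^+ j * 'C(k, j)%:R) *: shiftp p (j%:R * c)); last first.
  by rewrite [RHS]big_ord_recr /= bin_small // mulr0 scale0r addr0.
rewrite big_ord_recl /= !bin0 -addrA; congr (_ + _).
rewrite shiftp_sum -sumrB; apply: eq_bigr => j _.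
rewrite /bump /= add1n shiftpZ shiftp_shiftp binS natrD exprS.
have -> : j%:R * c + c = j.+1%:R * c by rewrite -natr1; ring.
by rewrite -scalerBl; congr (_ *: _); ring.
Qed.

Lemma fdiff_surj (R : realType) (Q : {poly R}) :
  exists P : {poly R}, P - shiftp P (-1) = Q.
Proof.
suff: forall n (Q : {poly R}), (size Q <= n)%N -> exists P, fdiff (-1) P = Q.
  by move=> /(_ (size Q) Q (leqnn _)).
elim=> [|n IHn] {}Q sQ.
  exists 0; rewrite /fdiff /shiftp comp_poly0 subrr.
  by apply/esym/eqP; rewrite -size_poly_leq0.
pose P0 : {poly R} := (Q`_n / n.+1%:R) *: 'X^(n.+1).
have sP0 : (size P0 <= n.+2)%N.
  by apply: leq_trans (size_scale_leq _ _) _; rewrite size_polyXn.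
have [s0 c0] := fdiff_step (-1) sP0.
have [|P1 P1E] := IHn (Q - fdiff (-1) P0).
  apply/leq_sizeP => j le_nj; rewrite coefB.
  case: (ltngtP n j) le_nj => // [lt_nj | <-] _.
    by rewrite !nth_default ?subrr // (leq_trans _ lt_nj).
  rewrite c0 // opprK mul1r coefZ coefXn eqxx mulr1 mulrCA divff ?pnatr_eq0 //.
  by rewrite mulr1 subrr.
exists (P1 + P0); rewrite -[RHS](subrK (fdiff (-1) P0)) -P1E.
rewrite /fdiff shiftpD; ring.
Qed.

Lemma size_antidiff (R : realType) (P Q : {poly R}) :
  P - shiftp P (-1) = Q -> Q != 0 -> size P = (size Q).+1.
Proof.
move=> PQ Q0; have sP : (1 < size P)%N.
  rewrite ltnNge; apply: contraNN Q0 => sP.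
  have [s0 _] := fdiff_step (-1) sP.
  by rewrite -size_poly_leq0 -PQ.
case sPE : (size P) sP => [|[|d]] // _; congr _.+1.
have [sQ cQ] := fdiff_step (-1) (eq_leq sPE).
apply/eqP; rewrite eq_sym eqn_leq -PQ sQ /= ltnNge.
apply/negP => /leq_sizeP/(_ d (leqnn d)); rewrite cQ // opprK mul1r => /eqP.
rewrite mulf_eq0 pnatr_eq0 /= -[d.+1]/(d.+2.-1) -sPE -lead_coefE lead_coef_eq0.
by rewrite -size_poly_eq0 sPE.
Qed.

(** ** Degrees of determinants *)

Lemma coefM_top (R : nzRingType) (p q : {poly R}) a b :
  (size p <= a.+1)%N -> (size q <= b.+1)%N ->
  (size (p * q)%R <= (a + b).+1)%N /\ (p * q)`_(a + b) = p`_a * q`_b.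
Proof.
move=> sp sq; split.
  apply: leq_trans (size_polyMleq _ _) _.
  by have := leq_add sp sq; rewrite addSn addnS; case: (_ + _)%N.
have lt_a : (a < (a + b).+1)%N by lia.
rewrite coefM (bigD1 (Ordinal lt_a)) //= addKn big1 ?addr0 // => j.
rewrite -val_eqE /= => ne_ja; have [lt_ja | le_aj] := ltnP j a.
  by rewrite [q`__]nth_default ?mulr0 //; apply: leq_trans sq _; lia.
by rewrite [p`__]nth_default ?mul0r //; apply: leq_trans sp _; lia.
Qed.

Lemma coef_prod_top (R : comNzRingType) (m : nat) (F : 'I_m -> {poly R})
    (d : 'I_m -> nat) : (forall i, (size (F i) <= (d i).+1)%N) ->
  (size (\prod_i F i)%R <= (\sum_i d i).+1)%N /\
  (\prod_i F i)`_(\sum_i d i) = \prod_i (F i)`_(d i).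
Proof.
move=> sF; elim/big_ind3: _ => [|p1 d1 c1 p2 d2 c2|i _] //.
- by rewrite size_poly1 coef1.
- by move=> [s1 <-] [s2 <-]; exact: coefM_top.
Qed.

(** The bound [d l] is the same along the row [l], so all Leibniz terms have the
    same degree bound and their top coefficients form a determinant again. *)
Lemma coef_det_top (R : comNzRingType) (m : nat) (A : 'M[{poly R}]_m)
    (d : 'I_m -> nat) : (forall l k, (size (A l k) <= (d l).+1)%N) ->
  (size (\det A)%R <= (\sum_i d i).+1)%N /\
  (\det A)`_(\sum_i d i) = \det (\matrix_(l, k) (A l k)`_(d l)).
Proof.
move=> sA; have top s := coef_prod_top (fun l => sA l (s l)).
have sgnE (s : bool) (p : {poly R}) : (-1) ^+ s * p = (-1) ^+ s *: p.
  by rewrite -mul_polyC polyC_exp polyCN.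
split.
  apply: leq_trans (size_sum _ _ _) _; apply/bigmax_leqP => s _.
  by rewrite sgnE; apply: leq_trans (size_scale_leq _ _) _; have [] := top s.
rewrite coef_sum; apply: eq_bigr => s _; rewrite sgnE coefZ; congr (_ * _).
by have [_ ->] := top s; apply: eq_bigr => l _; rewrite mxE.
Qed.

(** ** The determinant of falling factorials *)

Lemma size_falling (R : nzRingType) k :
  size (\prod_(i < k) ('X - (i%:R : R)%:P)) = k.+1 /\
  \prod_(i < k) ('X - (i%:R : R)%:P) \is monic.
Proof.
split; last exact: monic_prod_XsubC.
by rewrite size_prod_XsubC -[index_enum _]enumT size_enum_ord.
Qed.

Lemma horner_falling (R : comNzRingType) k d :
  (\prod_(i < k) ('X - (i%:R : R)%:P)).[d%:R] = (d ^_ k)%:R.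
Proof.
rewrite horner_prod; elim: k => [|k IHk]; first by rewrite big_ord0 ffactn0.
rewrite big_ord_recr /= IHk hornerXsubC ffactnSr natrM.
have [le_kd | lt_dk] := leqP k d; first by rewrite natrB.
by rewrite ffact_small // !mul0r.
Qed.

(** A vanishing combination of columns is a polynomial of degree less than [m],
    written in the basis of falling factorials, with the [m] roots [d l]. *)
Lemma det_falling_neq0 (R : numFieldType) (m : nat) (d : 'I_m -> nat) :
  injective d -> \det (\matrix_(l, k) (d l ^_ k)%:R : 'M[R]_m) != 0.
Proof.
move=> d_inj; rewrite -det_tr; apply/negP => /det0P[w /negP w0 wA].
pose ff k : {poly R} := \prod_(i < k) ('X - (i%:R : R)%:P).
pose p (n : nat) : {poly R} := \sum_(k < m | (k < n)%N) w 0 k *: ff k.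
have sp n : (size (p n) <= n)%N.
  apply: leq_trans (size_sum _ _ _) _; apply/bigmax_leqP => k lt_kn.
  by apply: leq_trans (size_scale_leq _ _) _; have [-> _] := size_falling R k.
have pm0 : p m = 0.
  apply: (@roots_geq_poly_eq0 _ _ [seq (d l)%:R | l : 'I_m]).
  - apply/allP => _ /mapP[l _ ->]; apply/rootP; rewrite horner_sum.
    have /rowP/(_ l) := wA; rewrite !mxE => E; rewrite -[RHS]E.
    rewrite big_mkcond; apply: eq_bigr => k _.
    by rewrite ltn_ord hornerZ horner_falling !mxE.
  - rewrite map_inj_uniq ?enum_uniq // => i j /eqP.
    by rewrite eqr_nat => /eqP/d_inj.
  - by rewrite size_map size_enum_ord sp.
apply: w0; apply/eqP/rowP => k; rewrite mxE.
suff: forall n, (n <= m)%N -> p n = 0 -> forall k : 'I_m, (k < n)%N -> w 0 k = 0.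
  by move=> /(_ m (leqnn m) pm0 k); apply.
elim=> [|n IHn] // lt_nm pn {}k le_kn.
have pnS : p n.+1 = w 0 (Ordinal lt_nm) *: ff n + p n.
  rewrite {1}/p (bigD1 (Ordinal lt_nm)) //=; congr (_ + _).
  apply: eq_bigl => i; rewrite -val_eqE /=; lia.
have wn : w 0 (Ordinal lt_nm) = 0.
  have := congr1 (fun f : {poly R} => f`_n) pnS.
  rewrite pn coef0 coefD coefZ (nth_default _ (sp n)) addr0.
  have [sf /monicP] := size_falling R n; rewrite lead_coefE sf /= => ->.
  by rewrite mulr1.
move: le_kn; rewrite ltnS leq_eqVlt => /orP[/eqP kn | lt_kn].
  by rewrite -wn; congr (w 0 _); apply: val_inj.
by apply: IHn => //; [exact: ltnW | rewrite -pn pnS wn scale0r add0r].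
Qed.

(** * Degrees of Casorati determinants and of the coefficients [krallM] *)

(** Column operations that turn consecutive shifts into iterated differences.  Its
    determinant is a sign, so it also relates the adjugates. *)
Definition binomial_mx (R : realType) (m : nat) : 'M[{poly R}]_m :=
  \matrix_(j, k) ((-1) ^+ j * 'C(k, j)%:R)%:P.

Definition diff_casorati (R : realType) (m : nat) (r : 'I_m -> {poly R}) :
    'M[{poly R}]_m :=
  \matrix_(l, k) iter k (fdiff (-1)) (shiftp (r l) (-1)).

Lemma casorati_binomial (R : realType) (m : nat) (r : 'I_m -> {poly R}) :
  casorati r *m binomial_mx R m = diff_casorati r.
Proof.
apply/matrixP => l k; rewrite [RHS]mxE (iter_fdiff_sum _ _ (ltn_ord k)) mxE.
apply: eq_bigr => j _; rewrite !mxE mulrC mul_polyC shiftp_shiftp.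
by congr (_ *: shiftp _ _); rewrite -natr1; ring.
Qed.

Lemma det_binomial_mx (R : realType) (m : nat) :
  exists2 c : R, c * c = 1 & \det (binomial_mx R m) = c%:P.
Proof.
exists (\prod_(i < m) (-1) ^+ i).
  by rewrite -big_split big1 // => i _; rewrite /= -expr2 sqrr_sign.
rewrite -det_tr det_trig.
  rewrite rmorph_prod; apply: eq_bigr => i _.
  by rewrite !mxE binn mulr1.
apply/is_trig_mxP => i j lt_ij; rewrite !mxE bin_small //.
by rewrite mulr0.
Qed.

Lemma mulmx_det_cancel (R : idomainType) (m n : nat) (A : 'M[R]_m)
    (X Y : 'M[R]_(m, n)) :
  \det A != 0 -> A *m X = A *m Y -> X = Y.
Proof.
move=> A0 AXY; have /matrixP E : \det A *: X = \det A *: Y.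
  by rewrite -!mul_scalar_mx -mul_adj_mx -!mulmxA AXY.
apply/matrixP => i j; apply: (mulfI A0).
by have := E i j; rewrite [LHS]mxE [RHS]mxE.
Qed.

Lemma adj_unique (R : idomainType) (m : nat) (A X : 'M[R]_m) :
  \det A != 0 -> A *m X = (\det A)%:M -> X = \adj A.
Proof.
by move=> A0 AX; apply: (mulmx_det_cancel A0); rewrite AX mul_mx_adj.
Qed.

Lemma casorati_shift_top (R : realType) (r : {poly R}) d k :
  (size r <= d.+1)%N ->
  (size (iter k (fdiff (-1)) (shiftp r (-1)) * 'X^k)%R <= d.+1)%N /\
  (iter k (fdiff (-1)) (shiftp r (-1)) * 'X^k)`_d = (d ^_ k)%:R * r`_d.
Proof.
move=> sr; have sr' : (size (shiftp r (-1)) <= d.+1)%N by rewrite size_shiftp.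
have [s0 ->] := iter_fdiff_lead (-1) k sr'.
rewrite opprK expr1n mul1r coef_shiftp_top //; split => //.
apply/leq_sizeP => j lt_dj; rewrite coefMXn; case: ltnP => // le_kj.
by rewrite nth_default // (leq_trans s0) // leq_sub2r.
Qed.

Lemma det_mul_diagX (R : comNzRingType) (m : nat) (B : 'M[{poly R}]_m)
    (e : 'I_m -> nat) :
  \det (\matrix_(l, k) (B l k * 'X^(e k))) = \det B * 'X^(\sum_k e k).
Proof.
rewrite -prodrXr -[X in _ * X](_ : \det (diag_mx (\row_k 'X^(e k))) = _).
  rewrite -det_mulmx mul_mx_diag; congr (\det _).
  by apply/matrixP => l k; rewrite !mxE.
by rewrite det_diag; apply: eq_bigr => k _; rewrite mxE.
Qed.

Lemma size_polyMXn (R : idomainType) (p : {poly R}) n :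
  p != 0 -> size (p * 'X^n) = (size p + n)%N.
Proof.
have Xn0 : 'X^n != 0 :> {poly R} by rewrite monic_neq0 ?monicXn.
by move=> p0; rewrite (size_mul p0 Xn0) size_polyXn addnS.
Qed.

(** The leading term of the determinant is a product of leading coefficients and
    a determinant of falling factorials of the degrees. *)
Lemma size_det_casorati (R : realType) (m : nat) (r : 'I_m -> {poly R})
    (d : 'I_m -> nat) :
  injective d -> (forall l, size (r l) = (d l).+1) ->
  \det (casorati r) != 0 /\
  (size (\det (casorati r)) + \sum_(k < m) k = (\sum_l d l).+1)%N.
Proof.
move=> d_inj sr; pose B := diff_casorati r.
pose BX : 'M[{poly R}]_m := \matrix_(l, k) (B l k * 'X^k).
have sBX l k : (size (BX l k) <= (d l).+1)%N.
  by rewrite !mxE; have [] := casorati_shift_top k (eq_leq (sr l)).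
have [sdet cdet] := coef_det_top sBX.
have lead0 : (\det BX)`_(\sum_l d l) != 0.
  rewrite cdet (_ : \matrix_(l, k) _ = diag_mx (\row_l (r l)`_(d l)) *m
     (\matrix_(l, k) (d l ^_ k)%:R)).
    rewrite det_mulmx mulf_neq0 ?det_falling_neq0 // det_diag.
    apply/prodf_neq0 => l _; rewrite mxE -[d l]/((d l).+1.-1) -sr -lead_coefE.
    by rewrite lead_coef_eq0 -size_poly_eq0 sr.
  rewrite mul_diag_mx; apply/matrixP => l k; rewrite !mxE.
  by have [_ ->] := casorati_shift_top k (eq_leq (sr l)); rewrite mulrC.
have BXE : \det BX = \det B * 'X^(\sum_(k < m) k).
  exact: (det_mul_diagX B (fun k : 'I_m => k : nat)).
have B0 : \det B != 0.
  by apply: contraNneq lead0 => B0; rewrite BXE B0 mul0r coef0.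
have [c cc Uc] := det_binomial_mx R m.
have BE : \det B = \det (casorati r) * c%:P.
  by rewrite -Uc -det_mulmx casorati_binomial.
have A0 : \det (casorati r) != 0.
  by apply: contraNneq B0 => A0; rewrite BE A0 mul0r.
have c0 : c != 0 by apply: contra_eq_neq cc => ->; rewrite mul0r eq_sym oner_neq0.
split=> //.
have -> : size (\det (casorati r)) = size (\det B).
  by rewrite BE mulrC mul_polyC size_scale.
rewrite -size_polyMXn // -BXE; apply/eqP; rewrite eqn_leq sdet ltnNge.
apply/negP => /leq_sizeP/(_ _ (leqnn _)) E.
by rewrite E eqxx in lead0.
Qed.

Lemma krallM_diff (R : realType) (m : nat) (r : 'I_m -> {poly R})
    (S : {poly R}) (h : 'I_m) :
  \det (casorati r) != 0 ->
  exists c : R, krallM r S h = c *: \sum_(k < m)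
    iter k (fdiff 1) (shiftp (S * (\adj (diff_casorati r)) k h) 1).
Proof.
move=> A0; have [c cc Uc] := det_binomial_mx R m; exists c.
have adjE : \adj (casorati r) =
    c%:P *: (binomial_mx R m *m \adj (diff_casorati r)).
  apply/esym/adj_unique => //.
  rewrite -scalemxAr mulmxA casorati_binomial mul_mx_adj -casorati_binomial.
  rewrite det_mulmx Uc scale_scalar_mx mulrCA -polyCM cc mulr1 //.
rewrite /krallM adjE.
transitivity (\sum_(j < m) \sum_(k < m) (c * ((-1) ^+ j * 'C(k, j)%:R)) *:
  shiftp (shiftp (S * (\adj (diff_casorati r)) k h) 1) (j%:R * 1)).
  apply: eq_bigr => j _; rewrite !mxE mulr_sumr mulr_sumr shiftp_sum.
  apply: eq_bigr => k _; rewrite shiftp_shiftp -shiftpZ mulr1 -natr1 addrC.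
  by congr (shiftp _ _); rewrite !mxE -!mul_polyC polyCM; ring.
rewrite exchange_big scaler_sumr; apply: eq_bigr => k _ /=.
rewrite (iter_fdiff_sum _ _ (ltn_ord k)) scaler_sumr.
by apply: eq_bigr => j _; rewrite scalerA.
Qed.

(** Column [i] of [diff_casorati] has entries of degree at most [d l - i]; the
    cofactor misses row [h] and column [k]. *)
Lemma size_adj_diff_casorati (R : realType) (m : nat) (r : 'I_m -> {poly R})
    (d : 'I_m -> nat) (h k : 'I_m) :
  (forall l, (size (r l) <= (d l).+1)%N) ->
  (\adj (diff_casorati r)) k h != 0 ->
  (size ((\adj (diff_casorati r)) k h) + \sum_(i < m) i + d h <=
     (\sum_l d l + k).+1)%N.
Proof.
case: m r d h k => [|m] r d h k sr; first by case: h.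
rewrite mxE /cofactor; set N := row' h (col' k _).
have -> : size ((-1) ^+ (h + k) * \det N) = size (\det N).
  by rewrite -signr_odd; case: odd; rewrite ?mulN1r ?size_polyN ?mul1r.
rewrite mulf_eq0 signr_eq0 /= => N0.
pose NX : 'M[{poly R}]_m := \matrix_(a, b) (N a b * 'X^(lift k b)).
have sNX a b : (size (NX a b) <= (d (lift h a)).+1)%N.
  rewrite !mxE.
  by have [] := casorati_shift_top (lift k b) (sr (lift h a)).
have [+ _] := coef_det_top sNX.
rewrite (det_mul_diagX N (fun b : 'I_m => lift k b : nat)) size_polyMXn //.
have sumE (F : 'I_m.+1 -> nat) i : (\sum_l F l = F i + \sum_a F (lift i a))%N.
  by rewrite (bigD1_ord i).
rewrite (sumE d h) (sumE (fun i => i : nat) k) /=.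
set s1 := (\sum_(i < m) _)%N; set s2 := (\sum_(i < m) _)%N.
by move: (size _) => s; lia.
Qed.

(** In [krallM_diff] the k-th summand is a k-th difference, which makes up for
    the k extra degrees of the adjugate entries in the k-th row. *)
Lemma size_krallM (R : realType) (m : nat) (r : 'I_m -> {poly R})
    (d : 'I_m -> nat) (S : {poly R}) (h : 'I_m) :
  injective d -> (forall l, size (r l) = (d l).+1) ->
  (size (krallM r S h) <= size S + \sum_l d l - (\sum_(i < m) i + d h))%N.
Proof.
move=> d_inj sr; have [A0 _] := size_det_casorati d_inj sr.
have [c ->] := krallM_diff S h A0.
apply: leq_trans (size_scale_leq _ _) _; apply: leq_trans (size_sum _ _ _) _.
apply/bigmax_leqP => k _; set b := \adj _ k h.
have [->|Sb0] := eqVneq (S * b) 0.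
  have iter0 n : iter n (fdiff 1) (0 : {poly R}) = 0.
    by elim: n => //= n ->; rewrite /fdiff /shiftp comp_poly0 subrr.
  by rewrite /shiftp comp_poly0 iter0 size_poly0.
have [S0 b0] : S != 0 /\ b != 0 by move: Sb0; rewrite mulf_eq0 negb_or => /andP.
have sb := size_adj_diff_casorati (fun l => eq_leq (sr l)) b0.
have sSb := size_mul S0 b0.
have S1 : (0 < size S)%N by rewrite size_poly_gt0.
have b1 : (0 < size b)%N by rewrite size_poly_gt0.
have sq : (size (shiftp (S * b)%R 1) <= ((size S + size b).-2).+1)%N.
  rewrite size_shiftp sSb; move: S1 b1.
  by move: (size S) (size b) => x y; lia.
have [s0 _] := iter_fdiff_lead 1 k sq.
apply: leq_trans s0 _; move: sb S1 b1; rewrite -/b.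
move: (size S) (size b) (\sum_l d l)%N (\sum_(i < m) i)%N => x y z t.
by lia.
Qed.

(** * Bases of distinct degrees *)

Lemma casorati_change (R : realType) (m : nat) (r r' : 'I_m -> {poly R})
    (E : 'M[R]_m) :
  (forall h, r h = \sum_l E h l *: r' l) ->
  casorati r = map_mx polyC E *m casorati r'.
Proof.
move=> rE; apply/matrixP => h k; rewrite !mxE rE shiftp_sum.
by apply: eq_bigr => l _; rewrite !mxE shiftpZ mul_polyC.
Qed.

Lemma det_casorati_change (R : realType) (m : nat) (r r' : 'I_m -> {poly R})
    (E : 'M[R]_m) :
  (forall h, r h = \sum_l E h l *: r' l) ->
  \det (casorati r) = \det E *: \det (casorati r').
Proof.
by move=> /casorati_change ->; rewrite det_mulmx det_map_mx mul_polyC.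
Qed.

(** The adjugate is contravariant in the basis, which makes [krallM] dual to the
    family [r]; hence [DS_change]. *)
Lemma krallM_change (R : realType) (m : nat) (r r' : 'I_m -> {poly R})
    (E : 'M[R]_m) (S : {poly R}) (l : 'I_m) :
  (forall h, r h = \sum_l E h l *: r' l) -> \det (casorati r) != 0 ->
  \sum_h E h l *: krallM r S h = \det E *: krallM r' S l.
Proof.
move=> rE A0; have AE := casorati_change rE.
have adjE : \adj (casorati r) *m map_mx polyC E =
    (\det E)%:P *: \adj (casorati r').
  apply: (mulmx_det_cancel A0); rewrite mulmxA mul_mx_adj -scalemxAr.
  rewrite {2}AE -mulmxA mul_mx_adj mul_mx_scalar mul_scalar_mx scalerA.
  by rewrite (det_casorati_change rE) mul_polyC.
rewrite /krallM scaler_sumr; under eq_bigr do rewrite scaler_sumr.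
rewrite exchange_big; apply: eq_bigr => j _ /=.
transitivity (shiftp (S * (\adj (casorati r) *m map_mx polyC E) j l) j.+1%:R).
  rewrite mxE mulr_sumr shiftp_sum; apply: eq_bigr => h _.
  by rewrite -shiftpZ [map_mx _ _ _ _]mxE [_ * _%:P]mulrC mul_polyC scalerAr.
by rewrite adjE mxE mul_polyC -scalerAr shiftpZ.
Qed.

(** Among all families generating [r] linearly, one with least total size has
    pairwise distinct degrees: otherwise subtracting a multiple of one member
    from another of the same degree would lower the total. *)
Lemma distinct_degrees (R : realType) (m : nat) (r : 'I_m -> {poly R}) :
  \det (casorati r) != 0 ->
  exists E : 'M[R]_m, exists r' : 'I_m -> {poly R}, exists d : 'I_m -> nat,
    [/\ forall h, r h = \sum_l E h l *: r' l, injective d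
      & forall l, size (r' l) = (d l).+1].
Proof.
move=> A0; pose gen (E : 'M[R]_m) (r' : 'I_m -> {poly R}) :=
  forall h, r h = \sum_l E h l *: r' l.
pose Q n := `[< exists E r', gen E r' /\ (\sum_l size (r' l) = n)%N >].
have Q0 : exists n, Q n.
  exists (\sum_l size (r l))%N; apply/asboolP; exists 1%:M, r; split => // h.
  rewrite (bigD1 h) //= big1 => [|l /negPf ne_lh].
    by rewrite !mxE eqxx scale1r addr0.
  by rewrite !mxE eq_sym ne_lh scale0r.
case: (ex_minnP Q0) => n /asboolP[E [r' [rE sn]]] n_min.
have r'0 l : r' l != 0.
  apply: contraNneq A0 => r'l0; rewrite (det_casorati_change rE).
  suff -> : \det (casorati r') = 0 by rewrite scaler0.
  rewrite (expand_det_row _ l) big1 // => k _.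
  by rewrite mxE r'l0 /shiftp comp_poly0 mul0r.
exists E, r', (fun l => (size (r' l)).-1); split => //; last first.
  by move=> l; rewrite prednK // size_poly_gt0.
move=> i j sij; apply/eqP/negP => /negP ne_ij.
have s_ij : size (r' i) = size (r' j).
  by rewrite -[LHS]prednK ?size_poly_gt0 // sij prednK ?size_poly_gt0.
pose a := lead_coef (r' i) / lead_coef (r' j).
pose r2 l := if l == i then r' i - a *: r' j else r' l.
have r2i : (size (r2 i) < size (r' i))%N.
  rewrite /r2 eqxx; have si : (0 < size (r' i))%N by rewrite size_poly_gt0.
  have si' : size (r' j) = (size (r' i)).-1.+1 by rewrite prednK.
  have := @size_sub_lead _ (r' i) (r' j) (size (r' i)).-1.
  rewrite prednK // -s_ij => /(_ (leqnn _) erefl).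
  by rewrite /a !lead_coefE -s_ij -ltnS prednK.
pose E2 : 'M[R]_m := \matrix_(h, l) (E h l + (l == j)%:R * a * E h i).
have gen2 : gen E2 r2.
  move=> h; rewrite rE.
  under [RHS]eq_bigr do rewrite mxE scalerDl.
  rewrite big_split /= [X in _ + X](bigD1 j) //= [X in _ + (_ + X)]big1.
    rewrite eqxx mul1r addr0 {2}/r2 eq_sym (negPf ne_ij).
    rewrite (bigD1 i) //= [in RHS](bigD1 i) //= {1}/r2 eqxx scalerBr scalerA.
    rewrite [a * _]mulrC addrAC subrK; congr (_ + _).
    by apply: eq_bigr => l /negPf ne_li; rewrite /r2 ne_li.
  by move=> l /negPf ->; rewrite !mul0r scale0r.
have := n_min (\sum_l size (r2 l))%N.
have -> : Q (\sum_l size (r2 l))%N by apply/asboolP; exists E2, r2.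
move=> /(_ isT); rewrite leqNgt -sn (bigD1 i) //= [X in (_ < X)%N](bigD1 i) //=.
rewrite (_ : \sum_(l | l != i) size (r2 l) = \sum_(l | l != i) size (r' l))%N.
  by rewrite ltn_add2r r2i.
by apply: eq_bigr => l /negPf ne_li; rewrite /r2 ne_li.
Qed.

Lemma size_comb_max (R : idomainType) (n : nat) (f : 'I_n -> {poly R})
    (d : 'I_n -> nat) (w : 'I_n -> R) (k : 'I_n) :
  injective d -> (forall l, size (f l) = (d l).+1) -> w k != 0 ->
  (forall l, w l != 0 -> (d l <= d k)%N) ->
  size (\sum_l w l *: f l) = (d k).+1.
Proof.
move=> d_inj sf wk max_k; rewrite (bigD1 k) //= size_polyDl size_scale ?sf //.
rewrite ltnS; apply: leq_trans (size_sum _ _ _) _.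
apply/bigmax_leqP => l ne_lk; have [->|wl] := eqVneq (w l) 0.
  by rewrite scale0r size_poly0.
rewrite size_scale // sf ltn_neqAle max_k // andbT.
by apply: contraNneq ne_lk => /d_inj ->.
Qed.

Lemma comb_argmax (R : nzRingType) (n : nat) (d : 'I_n -> nat) (w : 'I_n -> R) :
  (exists l, w l != 0) ->
  exists2 k, w k != 0 & forall l, w l != 0 -> (d l <= d k)%N.
Proof.
move=> [l0 wl0]; exists [arg max_(k > l0 | w k != 0%R) d k]%N;
  by case: arg_maxnP.
Qed.

(** In a combination of polynomials of pairwise distinct degrees nothing cancels
    in the highest degree. *)
Lemma degree_set (R : realType) (m : nat) (r r' : 'I_m -> {poly R})
    (E : 'M[R]_m) (d : 'I_m -> nat) (e : nat) :
  (forall h, r h = \sum_l E h l *: r' l) -> E \in unitmx ->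
  injective d -> (forall l, size (r' l) = (d l).+1) ->
  (exists l, d l = e) <->
  (exists v : 'I_m -> R, size (\sum_h v h *: r h) = e.+1).
Proof.
move=> rE Eu d_inj sr; split=> [[l <-] | [v sv]].
  exists (fun h => invmx E l h); rewrite -sr; congr (size (polyseq _)).
  transitivity (\sum_k (invmx E *m E) l k *: r' k).
    under eq_bigr do rewrite rE scaler_sumr.
    rewrite exchange_big; apply: eq_bigr => k _ /=.
    by rewrite mxE scaler_suml; apply: eq_bigr => h _; rewrite scalerA.
  rewrite mulVmx // (bigD1 l) //= big1 => [|k /negPf ne_kl].
    by rewrite mxE eqxx scale1r addr0.
  by rewrite mxE eq_sym ne_kl scale0r.
pose w k := \sum_h v h * E h k.
have vE : \sum_h v h *: r h = \sum_k w k *: r' k.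
  under eq_bigr do rewrite rE scaler_sumr.
  rewrite exchange_big; apply: eq_bigr => k _ /=.
  by rewrite scaler_suml; apply: eq_bigr => h _; rewrite scalerA.
have [|k wk max_k] := @comb_argmax _ _ d w.
  apply: contrapT => w0; suff : size (\sum_h v h *: r h) = 0%N by rewrite sv.
  rewrite vE big1 ?size_poly0 // => k _.
  by have [->|wk] := eqVneq (w k) 0; [rewrite scale0r | case: w0; exists k].
by exists k; apply: succn_inj; rewrite -sv vE (size_comb_max d_inj sr wk max_k).
Qed.

Lemma sum_injective_image (m N : nat) (d : 'I_m -> nat) (P : pred nat) :
  injective d -> (forall l, (d l < N)%N) ->
  (forall e, (e < N)%N -> P e <-> exists l, d l = e) ->
  (\sum_l d l = \sum_(e < N | P e) e)%N.
Proof.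
move=> d_inj dN PE; pose f l : 'I_N := Ordinal (dN l).
have f_inj : injective f by move=> i j [] /d_inj.
rewrite (eq_bigl (fun e => e \in f @: [set: 'I_m]%SET)).
  rewrite big_imset /=; last by move=> i j _ _; exact: f_inj.
  by apply: eq_bigl => l; rewrite inE.
move=> e; apply/idP/imsetP => [/(PE e (ltn_ord e))[l dl] | [l _ ->]].
  by exists l; [rewrite inE | apply: val_inj].
by apply/(PE _ (dN l)); exists l.
Qed.

(** * The weighted rank is the degree of [Omega] *)

Lemma mem_span_enum (K : fieldType) (V : vectType K) (n : nat) (P : pred 'I_n)
    (f : 'I_n -> V) (x : V) :
  x \in <<[seq f k | k : 'I_n <- enum 'I_n & P k]>>%VS <->
  exists a : 'I_n -> K, x = \sum_(k | P k) a k *: f k.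
Proof.
split; last first.
  move=> [a ->]; apply: memv_suml => k Pk; apply: memvZ; apply: memv_span.
  by apply: map_f; rewrite mem_filter Pk mem_enum.
rewrite span_def big_map big_filter big_enum_cond /= => /memv_sumP[vs vsP ->].
have /choice[a aP] : forall k, exists a : K, P k -> vs k = a *: f k.
  move=> k; case Pk: (P k); last by exists 0.
  by have /vlineP[a ->] := vsP k Pk; exists a.
by exists a; apply: eq_bigr => k Pk; exact: aP.
Qed.

(** A vector outside a row space has a nonzero image in the cokernel, and the
    columns of the cokernel matrix supply the functional [w]. *)
Lemma col_notin_span (K : fieldType) (m n : nat) (M : 'M[K]_(m, n)) (i : 'I_n) :
  (exists2 w : 'rV[K]_m, (w *m M) 0 i != 0 &
     forall k : 'I_n, (i < k)%N -> (w *m M) 0 k = 0) <->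
  col i M \notin <<[seq col k M | k : 'I_n <- enum 'I_n & (i < k)%N]>>%VS.
Proof.
split=> [[w wi wk] | ].
  apply/negP => /mem_span_enum[a ai]; move: wi.
  suff -> : (w *m M) 0 i = \sum_(k : 'I_n | (i < k)%N) a k * (w *m M) 0 k.
    by rewrite big1 ?eqxx // => k /wk ->; rewrite mulr0.
  have E k : (w *m M) 0 k = (w *m col k M) 0 0.
    by rewrite !mxE; apply: eq_bigr => l _; rewrite !mxE.
  rewrite E ai mulmx_sumr summxE; apply: eq_bigr => k _.
  by rewrite -scalemxAr mxE E.
pose N : 'M[K]_(m, n) := \matrix_(a, k) if (i < (k : 'I_n))%N then M a k else 0.
have [/submxP[D DE] | ] := boolP ((col i M)^T <= N^T)%MS.
  move=> /negP[]; apply/mem_span_enum; exists (fun k => D 0 k).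
  apply/colP => a; have /rowP/(_ a) := DE; rewrite !mxE => ->.
  rewrite summxE [RHS]big_mkcond; apply: eq_bigr => k _.
  by rewrite !mxE; case: ifP; rewrite ?mulr0.
rewrite submxE => /matrix0Pn[z [c]]; rewrite ord1 => nz _.
pose C := cokermx N^T; exists (col c C)^T.
  move: nz; congr (_ != _); rewrite !mxE; apply: eq_bigr => a _.
  by rewrite !mxE mulrC.
move=> k lt_ik; have /matrixP/(_ k c) := mulmx_coker N^T.
rewrite [RHS]mxE => E; rewrite -[RHS]E !mxE; apply: eq_bigr => a _.
by rewrite !mxE lt_ik mulrC.
Qed.

Lemma row_in_span (K : fieldType) (m n : nat) (M : 'M[K]_(m, n)) (j : 'I_m) :
  (exists w : 'rV[K]_m, [/\ w *m M = 0, w 0 j != 0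
     & forall k : 'I_m, (k < j)%N -> w 0 k = 0]) <->
  row j M \in <<[seq row k M | k : 'I_m <- enum 'I_m & (j < k)%N]>>%VS.
Proof.
split=> [[w [wM wj wk]] | /mem_span_enum[a ja]].
  apply/mem_span_enum; exists (fun k => - w 0 k / w 0 j).
  apply: (@scalerI _ _ (w 0 j)) => //; rewrite scaler_sumr.
  move: wM; rewrite mulmx_sum_row (bigD1 j) //=.
  rewrite (bigID (fun k : 'I_m => (j < k)%N)) /= addrA.
  rewrite [X in _ + X = _]big1 ?addr0 => [|k /andP[ne_kj]]; last first.
    rewrite -leqNgt leq_eqVlt => /orP[/eqP/val_inj kj|/wk ->].
      by rewrite kj eqxx in ne_kj.
    by rewrite scale0r.
  move/eqP; rewrite addr_eq0 => /eqP ->; rewrite -sumrN.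
  apply: eq_big => [k|k _].
    by apply/andP/idP => [[]//|lt_jk]; split=> //; rewrite -val_eqE gtn_eqF.
  by rewrite scalerA mulrCA divff // mulr1 scaleNr.
exists (\row_k if (k == j) then -1 else if (j < k)%N then a k else 0).
split.
- rewrite mulmx_sum_row (bigD1 j) //= mxE eqxx scaleN1r ja addrC.
  apply/eqP; rewrite subr_eq0; apply/eqP; rewrite big_mkcond [RHS]big_mkcond.
  apply: eq_bigr => k _; rewrite mxE.
  case: eqP => [->|_] /=; first by rewrite ltnn.
  by case: ifP => _; rewrite ?scale0r.
- by rewrite mxE eqxx oppr_eq0 oner_neq0.
- by move=> k lt_kj; rewrite mxE -val_eqE ltn_eqF // ltnNge ltnW.
Qed.

(** [wr_tilde] keeps a basis of the column space, hence the left kernel. *)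
Lemma mul_wr_tilde_eq0 (R : realType) (m alpha : nat) (M : 'M[R]_m)
    (w : 'rV[R]_m) :
  (0 < alpha)%N -> w *m wr_tilde alpha M = 0 <-> w *m M = 0.
Proof.
move=> a0; have colE k : (w *m wr_tilde alpha M) 0 k = (w *m M) 0 (enum_val k).
  by rewrite !mxE; apply: eq_bigr => l _; rewrite !mxE.
split=> [wT | wM]; last by apply/rowP => k; rewrite colE wM !mxE.
apply/rowP => i; rewrite [RHS]mxE.
have [d] := ubnP (m - i); elim: d i => // d IHd i le_d.
have [piv|] := boolP (i \in wr_cols alpha M).
  by rewrite -(enum_rankK_in piv piv) -colE wT mxE.
rewrite inE negbK /wr_n; case: ifP => [/mem_span_enum[a ai] _|_]; last first.
  by rewrite addn_eq0 eqn0Ngt a0.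
have E k : (w *m M) 0 k = (w *m col k M) 0 0.
  by rewrite !mxE; apply: eq_bigr => l _; rewrite !mxE.
rewrite E ai mulmx_sumr summxE big1 // => k lt_ik.
rewrite -scalemxAr mxE -E IHd ?mulr0 //.
have := ltn_ord k; have := ltn_ord i; lia.
Qed.

(** ** The degrees occurring in the span of the symbols *)

Lemma size_pochhammer (R : realType) (c : R) k :
  size (pochhammer ('X + c%:P) k) = k.+1 /\ pochhammer ('X + c%:P) k \is monic.
Proof.
have -> : pochhammer ('X + c%:P) k =
    \prod_(i < k) ('X - (- c - i%:R)%:P).
  by apply: eq_bigr => i _; rewrite polyCB polyCN -polyC_natr; ring.
split; last exact: monic_prod_XsubC.
by rewrite size_prod_XsubC -[index_enum _]enumT size_enum_ord.
Qed.

Lemma pochhammer_subnat (R : realType) i k :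
  pochhammer ('X - i%:R + 1 : {poly R}) k = pochhammer ('X + (1 - i%:R)%:P) k.
Proof. by rewrite polyCB polyC_natr polyC1; congr pochhammer; ring. Qed.

Definition low_basis (R : realType) (m : nat) (l : 'I_m) : {poly R} :=
  pochhammer ('X + 1) (m - l.+1).

Definition high_basis (R : realType) (m alpha : nat) (i : 'I_m) : {poly R} :=
  pochhammer ('X + 1) alpha * pochhammer ('X - i%:R + 1) i.

Lemma size_low_basis (R : realType) (m : nat) (l : 'I_m) :
  size (low_basis R l) = (m - l.+1).+1.
Proof.
by rewrite /low_basis -polyC1; have [->] := size_pochhammer (1 : R) (m - l.+1).
Qed.

Lemma size_high_basis (R : realType) (m alpha : nat) (i : 'I_m) :
  size (high_basis R alpha i) = (alpha + i).+1.
Proof.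
rewrite /high_basis pochhammer_subnat -polyC1.
have [s1 m1] := size_pochhammer (1 : R) alpha.
have [s2 m2] := size_pochhammer (1 - i%:R : R) i.
by rewrite size_mul ?monic_neq0 // s1 s2 addnS.
Qed.

(** With [w l = l! v l], a combination of the [Rpoly] with weights [v] has the
    entries of [w *m M] as coordinates in degrees [alpha] to [alpha + m - 1] and
    those of [w] itself in degrees [m - 1] to [0], up to nonzero factors. *)
Lemma Rpoly_comb (R : realType) (m alpha : nat) (M : 'M[R]_m) :
  (m <= alpha)%N ->
  exists a : 'I_m -> R, exists b : 'I_m -> R,
  [/\ forall l, a l != 0, forall i, b i != 0 &
   forall w : 'rV[R]_m,
   \sum_l (w 0 l / l`!%:R) *: Rpoly alpha M l =
   \sum_l (w 0 l * a l) *: low_basis R l +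
   \sum_i ((w *m M) 0 i * b i) *: high_basis R alpha i].
Proof.
move=> le_ma.
exists (fun l : 'I_m => (alpha - m + l)`!%:R / (m - l.+1)`!%:R / l`!%:R).
exists (fun i : 'I_m => (-1) ^+ i / (alpha + i)`!%:R); split.
- by move=> l; rewrite !mulf_neq0 ?invr_eq0 ?natr_fact_neq0.
- by move=> i; rewrite mulf_neq0 ?invr_eq0 ?natr_fact_neq0 ?signr_eq0.
move=> w; transitivity (\sum_l ((w 0 l *
   ((alpha - m + l)`!%:R / (m - l.+1)`!%:R / l`!%:R)) *: low_basis R l +
   \sum_i (w 0 l * M l i * ((-1) ^+ i / (alpha + i)`!%:R))
     *: high_basis R alpha i)).
  apply: eq_bigr => l _; rewrite /Rpoly scalerDr !scalerA.
  have -> : alpha%:R - m%:R + l.+1%:R = (alpha - m + l).+1%:R :> R.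
    by rewrite -natrB // -natrD addnS.
  rewrite Gamma_natS; congr (_ + _).
    by congr (_ *: _); ring.
  rewrite divfK ?natr_fact_neq0 // mulr_sumr scaler_sumr.
  apply: eq_bigr => i _; rewrite -scalerAr scalerA /high_basis.
  have -> : alpha%:R + i%:R + 1 = (alpha + i).+1%:R :> R.
    by rewrite -natr1 natrD.
  by rewrite Gamma_natS; congr (_ *: _); ring.
rewrite big_split /=; congr (_ + _); rewrite exchange_big /=.
apply: eq_bigr => i _; rewrite mxE mulr_suml scaler_suml.
by apply: eq_bigr.
Qed.

(** The basis polynomials have distinct degrees, and those of [high_basis] exceed
    those of [low_basis]: the degree of a combination is given by the last nonzero
    entry of [w *m M] or, if [w] is in the left kernel of [M], by the first
    nonzero entry of [w]. *)
Lemma Rpoly_span_degree (R : realType) (m alpha : nat) (M : 'M[R]_m)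
    (e : nat) :
  (m <= alpha)%N ->
  (exists v : 'I_m -> R, size (\sum_l v l *: Rpoly alpha M l) = e.+1) <->
  (exists2 i : 'I_m, e = (alpha + i)%N &
     exists2 w : 'rV[R]_m, (w *m M) 0 i != 0 &
       forall k : 'I_m, (i < k)%N -> (w *m M) 0 k = 0) \/
  (exists2 j : 'I_m, e = (m - j.+1)%N &
     exists w : 'rV[R]_m, [/\ w *m M = 0, w 0 j != 0
       & forall k : 'I_m, (k < j)%N -> w 0 k = 0]).
Proof.
move=> le_ma; have [a [b [a0 b0 combE]]] := Rpoly_comb M le_ma.
pose low (w : 'rV[R]_m) := \sum_l (w 0 l * a l) *: low_basis R l.
pose high (w : 'rV[R]_m) :=
  \sum_i ((w *m M) 0 i * b i) *: high_basis R alpha i.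
have low_inj : injective (fun l : 'I_m => m - l.+1)%N.
  by move=> x y; have := ltn_ord x; have := ltn_ord y; move=> *;
    apply: val_inj => /=; lia.
have high_inj : injective (fun i : 'I_m => alpha + i)%N.
  by move=> x y /addnI/val_inj.
have s_low w : (size (low w) <= m)%N.
  apply: leq_trans (size_sum _ _ _) _; apply/bigmax_leqP => l _.
  apply: leq_trans (size_scale_leq _ _) _; rewrite size_low_basis.
  by have := ltn_ord l; lia.
have s_high w (i : 'I_m) : (w *m M) 0 i != 0 ->
    (forall k : 'I_m, (i < k)%N -> (w *m M) 0 k = 0) ->
    size (low w + high w) = (alpha + i).+1.
  move=> wi wk; have sh : size (high w) = (alpha + i).+1.
    apply: (size_comb_max high_inj (size_high_basis R alpha)) => [|l].
      by rewrite mulf_neq0.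
    rewrite leq_add2l; have [//|lt_il] := leqP l i.
    by rewrite wk // mul0r eqxx.
  by rewrite addrC size_polyDl // sh; have := s_low w; lia.
have s_ker w (j : 'I_m) : w *m M = 0 -> w 0 j != 0 ->
    (forall k : 'I_m, (k < j)%N -> w 0 k = 0) ->
    size (low w + high w) = (m - j.+1).+1.
  move=> wM wj wk; have -> : high w = 0.
    by rewrite /high big1 // => i _; rewrite wM mxE mul0r scale0r.
  rewrite addr0; apply: (size_comb_max low_inj (@size_low_basis R m)) => [|l].
    by rewrite mulf_neq0.
  have [le_jl _|lt_lj] := leqP j l; first by rewrite leq_sub2l.
  by rewrite wk // mul0r eqxx.
split=> [[v sv] | [[i -> [w wi wk]] | [j -> [w [wM wj wk]]]]]; last 2 first.
- by exists (fun l => w 0 l / l`!%:R); rewrite combE; exact: s_high.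
- by exists (fun l => w 0 l / l`!%:R); rewrite combE; exact: s_ker.
pose w : 'rV[R]_m := \row_l (v l * l`!%:R).
have vE : \sum_l v l *: Rpoly alpha M l = low w + high w.
  rewrite -combE; apply: eq_bigr => l _.
  by rewrite mxE mulfK ?natr_fact_neq0.
rewrite vE in sv.
have [wM | wM0] := eqVneq (w *m M) 0.
  right; have [|j wj max_j] := @comb_argmax _ _ (fun l : 'I_m => m - l.+1)%N
      (fun l => w 0 l).
    apply: contrapT => w0; move: sv; rewrite /high wM.
    rewrite [X in _ + X]big1 ?addr0 => [|i _]; last by rewrite mxE mul0r scale0r.
    rewrite /low big1 ?size_poly0 // => l _.
    have [->|wl] := eqVneq (w 0 l) 0; first by rewrite mul0r scale0r.
    by case: w0; exists l.
  have wk (k : 'I_m) : (k < j)%N -> w 0 k = 0.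
    move=> lt_kj; apply/eqP/negP => /negP/max_j.
    by have := ltn_ord j; have := ltn_ord k; lia.
  exists j; last by exists w.
  by apply: succn_inj; rewrite -sv; exact: s_ker.
left; have [|i wi max_i] := @comb_argmax _ _ (fun l : 'I_m => l : nat)
    (fun l => (w *m M) 0 l).
  have /matrix0Pn[z [l]] := wM0; rewrite ord1 => wl.
  by exists l.
have wk (k : 'I_m) : (i < k)%N -> (w *m M) 0 k = 0.
  by move=> lt_ik; apply/eqP/negP => /negP/max_i; lia.
exists i; last by exists w.
by apply: succn_inj; rewrite -sv; exact: s_high.
Qed.

(** The basis of distinct degrees of [distinct_degrees] turns the degree of
    [Omega] into a sum of degrees, which the pivots of [M] describe. *)
Lemma degree_sum_alpha_wr (R : realType) (m alpha : nat) (M : 'M[R]_m)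
    (r' : 'I_m -> {poly R}) (E : 'M[R]_m) (d : 'I_m -> nat) :
  (0 < alpha)%N -> (m <= alpha)%N ->
  (forall h, Rpoly alpha M h = \sum_l E h l *: r' l) -> E \in unitmx ->
  injective d -> (forall l, size (r' l) = (d l).+1) ->
  (\sum_l d l = \sum_(i < m) wr_n alpha M i + \sum_(j < m) wr_m alpha M j)%N.
Proof.
move=> a0 le_ma rE Eu d_inj sr.
pose P e := `[< exists l, d l = e >].
pose g e := if P e then e else 0%N.
have dP e : P e <->
    (exists2 i : 'I_m, e = (alpha + i)%N & wr_n alpha M i = (alpha + i)%N) \/
    (exists2 j : 'I_m, e = (m - j.+1)%N &
       let Mt := wr_tilde alpha M in
       row j Mt \in <<[seq row k Mt | k : 'I_m <- enum 'I_m & (j < k)%N]>>%VS).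
  have wrn (i : 'I_m) : wr_n alpha M i = (alpha + i)%N <->
      col i M \notin <<[seq col k M | k : 'I_m <- enum 'I_m & (i < k)%N]>>%VS.
    rewrite /wr_n; case: ifP => // _; split=> // /esym/eqP.
    by rewrite addn_eq0 eqn0Ngt a0.
  have := degree_set e rE Eu d_inj sr; rewrite Rpoly_span_degree // => degE.
  rewrite /P; split=> [/asboolP/degE | H].
    case=> [[i ei wi] | [j ej [w [wM wj wk]]]].
      by left; exists i => //; apply/wrn/col_notin_span.
    right; exists j => //; apply/row_in_span; exists w; split => //.
    by apply/mul_wr_tilde_eq0.
  apply/asboolP/degE; case: H => [[i ei /wrn/col_notin_span wi] | [j ej]].
    by left; exists i.
  move=> /row_in_span[w [/mul_wr_tilde_eq0 wM wj wk]].
  by right; exists j => //; exists w; split => //; apply: wM.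
have dN l : (d l < alpha + m)%N.
  have /dP : P (d l) by apply/asboolP; exists l.
  case=> [[i -> _] | [j -> _]].
  by have := ltn_ord i; lia.
  by have := ltn_ord j; lia.
rewrite (@sum_injective_image _ _ _ P d_inj dN) => [|e _]; last first.
  by apply: iff_sym; apply: rwP; exact: asboolP.
rewrite big_mkcond -(big_mkord xpredT g) (@big_cat_nat _ _ _ m) //=; last by lia.
rewrite [X in (_ + X)%N](@big_cat_nat _ _ _ alpha) //=; last by lia.
rewrite [X in (_ + (X + _))%N]big_nat_cond [X in (_ + (X + _))%N]big1; last first.
  move=> e; rewrite andbT => /andP[le_me lt_ea]; rewrite /g; case: ifP => // /dP.
  by case=> [[i ei _] | [j ej _]]; [lia | have := ltn_ord j; lia].
rewrite add0n addnC; congr (_ + _)%N.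
  rewrite -{1}[alpha]add0n big_addn addKn big_mkord; apply: eq_bigr => i _.
  rewrite addnC /g; case: ifP => [/dP | /negP nP].
    case=> [[i' /addnI/val_inj <-] // | [j ej _]].
    by have := ltn_ord j; move: ej; lia.
  rewrite /wr_n; case: ifP => // ni; case: nP; apply/dP; left.
  by exists i => //; rewrite /wr_n ni.
rewrite big_mkord (reindex_inj rev_ord_inj); apply: eq_bigr => j _ /=.
rewrite /g /wr_m; case: ifP => [/dP | /negP nP].
  case=> [[i ei _] | [j' ej' rj']].
    by have := ltn_ord j; move: ei; lia.
  have -> : j = j'.
    by apply: val_inj => /=; have := ltn_ord j; have := ltn_ord j'; lia.
  by rewrite rj'.
case: ifP => // rj; case: nP; apply/dP; right.
by exists j.
Qed.

(** * Orders of differential operators *)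

(** The leading coefficient [c] may be 0, so that this also expresses upper bounds
    on the order. *)
Definition diffop_lead (R : realType) (T : {poly R} -> {poly R}) (s : nat)
    (c : {poly R}) : Prop :=
  exists2 f : nat -> {poly R}, f s = c &
    forall p : {poly R}, T p = \sum_(j < s.+1) f j * p^`(j).

Lemma diffop_lead_ext (R : realType) (T T' : {poly R} -> {poly R}) s c c' :
  T' =1 T -> c' = c -> diffop_lead T s c -> diffop_lead T' s c'.
Proof. by move=> TT' -> [f fs fT]; exists f => // p; rewrite TT'. Qed.

Lemma diffop_lead_id (R : realType) : @diffop_lead R id 0 1.
Proof.
by exists (fun=> 1) => // p; rewrite big_ord1 mul1r derivn0.
Qed.

Lemma diffop_lead0 (R : realType) s : @diffop_lead R (fun=> 0) s 0.
Proof. by exists (fun=> 0) => // p; rewrite big1 // => j _; rewrite mul0r. Qed.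

Lemma diffop_lead_widen (R : realType) (T : {poly R} -> {poly R}) s t c :
  (s < t)%N -> diffop_lead T s c -> diffop_lead T t 0.
Proof.
move=> lt_st [f _ fT]; exists (fun j => if (j <= s)%N then f j else 0).
  by rewrite leqNgt lt_st.
move=> p; rewrite fT (big_ord_widen t.+1 (fun j => f j * p^`(j))) 1?ltnW //.
rewrite big_mkcond; apply: eq_bigr => j _.
by rewrite ltnS; case: ifP; rewrite ?mul0r.
Qed.

Lemma diffop_leadD (R : realType) (T U : {poly R} -> {poly R}) s c e :
  diffop_lead T s c -> diffop_lead U s e ->
  diffop_lead (fun p => T p + U p) s (c + e).
Proof.
move=> [f fs fT] [g gs gU]; exists (fun j => f j + g j) => [|p].
  by rewrite fs gs.
by rewrite fT gU -big_split; apply: eq_bigr => j _; rewrite mulrDl.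
Qed.

Lemma diffop_leadM (R : realType) (T : {poly R} -> {poly R}) s c a :
  diffop_lead T s c -> diffop_lead (fun p => a * T p) s (a * c).
Proof.
move=> [f fs fT]; exists (fun j => a * f j) => [|p]; first by rewrite fs.
by rewrite fT mulr_sumr; apply: eq_bigr => j _; rewrite mulrA.
Qed.

Lemma diffop_lead_sum0 (R : realType) (I : finType)
    (T : I -> {poly R} -> {poly R}) s :
  (forall i, diffop_lead (T i) s 0) ->
  diffop_lead (fun p => \sum_i T i p) s 0.
Proof.
move=> T0; elim: (index_enum I) => [|i r IHr].
  apply: diffop_lead_ext (diffop_lead0 R s) => // p.
  by rewrite big_nil.
apply: diffop_lead_ext (diffop_leadD (T0 i) IHr) => [p|]; last by rewrite addr0.
by rewrite big_cons.
Qed.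

Lemma deriv_sum (R : nzRingType) (I : Type) (s : seq I) (F : I -> {poly R}) :
  (\sum_(i <- s) F i)^`() = \sum_(i <- s) (F i)^`().
Proof. exact: linear_sum. Qed.

Lemma diffop_lead_deriv (R : realType) (T : {poly R} -> {poly R}) s c :
  diffop_lead T s c -> diffop_lead (fun p => (T p)^`()) s.+1 c.
Proof.
move=> [f fs fT].
exists (fun j => (if (j <= s)%N then (f j)^`() else 0) +
                 (if j is i.+1 then f i else 0)).
  by rewrite ltnn add0r fs.
move=> p; rewrite fT deriv_sum.
under eq_bigr do rewrite derivM -derivnS.
rewrite big_split /=; under [RHS]eq_bigr do rewrite mulrDl.
rewrite [RHS]big_split /=; congr (_ + _).
  rewrite [RHS]big_ord_recr /= ltnn mul0r addr0; apply: eq_bigr => j _.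
  by rewrite -ltnS ltn_ord.
by rewrite [RHS]big_ord_recl /= mul0r add0r; apply: eq_bigr.
Qed.

Lemma diffop_lead_Dalpha (R : realType) (a : nat) (T : {poly R} -> {poly R}) s
    c :
  diffop_lead T s c -> diffop_lead (fun p => Dalpha a (T p)) s.+2 (- 'X * c).
Proof.
move=> Ts; have T1 := diffop_lead_deriv Ts; have T2 := diffop_lead_deriv T1.
have lo := diffop_leadM (- ((a%:R + 1)%:P - 'X))
  (diffop_lead_widen (ltnSn _) T1).
apply: diffop_lead_ext (diffop_leadD (diffop_leadM (- 'X) T2) lo) => [p|].
  by rewrite /Dalpha derivnS derivn1 mulNr [in RHS]mulNr.
by rewrite mulr0 addr0.
Qed.

Lemma diffop_lead_poly_op (R : realType) (a : nat) (T : {poly R} -> {poly R}) s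
    c (P : {poly R}) k :
  (size P <= k.+1)%N -> diffop_lead T s c ->
  diffop_lead (fun p => poly_op P (Dalpha a) (T p)) (s + k.*2)
    (P`_k *: ((- 'X) ^+ k * c)).
Proof.
move=> sP Ts.
have it i : diffop_lead (fun p => iter i (Dalpha a) (T p)) (s + i.*2)
    ((- 'X) ^+ i * c).
  elim: i => [|i IHi]; first by rewrite addn0 expr0 mul1r.
  rewrite doubleS !addnS exprS -mulrA; exact: diffop_lead_Dalpha IHi.
suff H n : diffop_lead (fun p => \sum_(i < n.+1) P`_i *: iter i (Dalpha a) (T p))
    (s + n.*2) (P`_n *: ((- 'X) ^+ n * c)).
  by apply: diffop_lead_ext (H k) => // p; rewrite (poly_op_widen _ _ sP).
have term i := diffop_leadM (P`_i)%:P (it i).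
elim: n => [|n IHn].
  apply: diffop_lead_ext (term 0%N) => [p|]; last by rewrite mul_polyC.
  by rewrite big_ord1 mul_polyC.
have lt_n : (s + n.*2 < s + n.+1.*2)%N by rewrite ltn_add2l ltn_double.
apply: diffop_lead_ext (diffop_leadD (diffop_lead_widen lt_n IHn) (term n.+1)).
  by move=> p; rewrite big_ord_recr /= mul_polyC.
by rewrite add0r mul_polyC.
Qed.

Lemma poly_op_comb (R : realType) (T : {poly R} -> {poly R}) (f : {poly R})
    (n : nat) (c : 'I_n -> R) (P : 'I_n -> {poly R}) :
  poly_op (\sum_i c i *: P i) T f = \sum_i c i *: poly_op (P i) T f.
Proof.
have lin (a : R) (P1 P2 : {poly R}) :
    poly_op (a *: P1 + P2) T f = a *: poly_op P1 T f + poly_op P2 T f.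
  pose N := maxn (size P1) (size P2).
  rewrite (@poly_op_widen _ P1 _ _ N) ?leq_maxl //.
  rewrite (@poly_op_widen _ P2 _ _ N) ?leq_maxr //.
  rewrite (@poly_op_widen _ (a *: P1 + P2) _ _ N).
    rewrite scaler_sumr -big_split; apply: eq_bigr => i _ /=.
    by rewrite coefD coefZ scalerDl scalerA.
  apply: leq_trans (size_polyD _ _) _; rewrite geq_max leq_maxr andbT.
  by apply: leq_trans (size_scale_leq _ _) _; rewrite leq_maxl.
exact: (linear_op_sum _ c P lin).
Qed.

Lemma DS_change (R : realType) (m alpha : nat) (M : 'M[R]_m) (S P : {poly R})
    (r' : 'I_m -> {poly R}) (E : 'M[R]_m) (p : {poly R}) :
  (forall h, Rpoly alpha M h = \sum_l E h l *: r' l) ->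
  Omega alpha M != 0 ->
  DS alpha M S P p = poly_op P (Dalpha alpha) p +
    \sum_l (\det E)%:P * poly_op (krallM r' S l) (Dalpha alpha)
      (poly_op (r' l) (Dalpha alpha) p)^`().
Proof.
move=> rE O0; rewrite /DS; congr (_ + _).
transitivity (\sum_(h < m) \sum_l E h l *:
    poly_op (krallM (Rpoly alpha M) S h) (Dalpha alpha)
      (poly_op (r' l) (Dalpha alpha) p)^`()).
  apply: eq_bigr => h _; rewrite MpolyE rE poly_op_comb deriv_sum.
  under eq_bigr do rewrite derivZ.
  by rewrite (linear_op_sum _ _ _ (poly_op_linear _ (@Dalpha_linear R alpha))).
rewrite exchange_big; apply: eq_bigr => l _ /=.
rewrite -poly_op_comb (krallM_change S l rE O0) mul_polyC.
have := poly_op_comb (Dalpha alpha) (poly_op (r' l) (Dalpha alpha) p)^`()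
  (fun _ : 'I_1 => \det E) (fun=> krallM r' S l).
by rewrite !big_ord1.
Qed.

Lemma sum_ord_half (m : nat) : (\sum_(k < m) k = (m * (m - 1)) %/ 2)%N.
Proof.
by rewrite -(big_mkord xpredT id) bin2_sum bin2 subn1 divn2.
Qed.

(** In a basis of distinct degrees [d l], the degrees of [krallM r' S l] and of
    [r' l] add up to at most [deg S + deg Omega = deg P - 1], so every summand
    of the sum over [l] has order less than the order [2 * deg P] of the first
    term of [DS]. *)
Lemma DS_order (R : realType) (m alpha : nat) (M : 'M[R]_m) (S P : {poly R}) :
  (0 < alpha)%N -> (m <= alpha)%N -> S != 0 ->
  P - shiftp P (-1) = S * Omega alpha M ->
  diffop_order (DS alpha M S P) (size P).-1.*2 /\
  (size P).-1%:Z = (size S).-1%:Z + alpha_wr alpha M + 1.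
Proof.
move=> a0 le_ma S0 dP.
have O0 : Omega alpha M != 0.
  by apply: contraNneq (Omega0_neq0 M le_ma) => ->; rewrite horner0.
have [E [r' [d [rE d_inj sr]]]] := distinct_degrees O0.
have detE := det_casorati_change rE; rewrite -Omega_casorati in detE.
have E0 : \det E != 0.
  by apply: contraNneq O0 => E0; rewrite detE E0 scale0r.
have Eu : E \in unitmx by rewrite unitmxE unitfE.
have [A0 sA] := size_det_casorati d_inj sr.
have sO : size (Omega alpha M) = size (\det (casorati r')).
  by rewrite detE size_scale.
have wrE := degree_sum_alpha_wr a0 le_ma rE Eu d_inj sr.
have sP : size P = (size S + size (\det (casorati r')))%N.
  rewrite (size_antidiff dP) ?mulf_neq0 // (size_mul S0 O0) sO prednK //.
  by rewrite addn_gt0 size_poly_gt0 S0.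
have S1 : (0 < size S)%N by rewrite size_poly_gt0.
have A1 : (0 < size (\det (casorati r')))%N by rewrite size_poly_gt0.
split; last first.
  rewrite /alpha_wr sP -sum_ord_half -PoszD -wrE; move: sA S1 A1.
  move: (size S) (size (\det (casorati r'))) (\sum_(k < m) k)%N (\sum_l d l)%N => x y z t; lia.
have P0 : P != 0 by rewrite -size_poly_gt0 sP; lia.
have sPk : (size P <= (size P).-1.+1)%N by rewrite prednK // size_poly_gt0.
have lead := diffop_lead_poly_op alpha sPk (diffop_lead_id R).
suff low l : diffop_lead (fun p => (\det E)%:P *
    poly_op (krallM r' S l) (Dalpha alpha)
      (poly_op (r' l) (Dalpha alpha) p)^`()) (0 + (size P).-1.*2) 0.
  have [f fs fT] := diffop_leadD lead (diffop_lead_sum0 low).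
  exists f; split; last by move=> p; rewrite (DS_change _ _ _ rE O0) fT.
  rewrite fs addr0 scaler_eq0 mulr1 expf_eq0 oppr_eq0 polyX_eq0 andbF orbF.
  by rewrite -lead_coefE lead_coef_eq0.
have sK := size_krallM S l d_inj sr.
have [K0 | K0] := eqVneq (krallM r' S l) 0.
  apply: diffop_lead_ext (diffop_lead0 R _) => // p.
  by rewrite K0 /poly_op size_poly0 big_ord0 mulr0.
have K1 : (0 < size (krallM r' S l))%N by rewrite size_poly_gt0.
have sKk : (size (krallM r' S l) <= (size (krallM r' S l)).-1.+1)%N.
  by rewrite prednK.
have opr := diffop_lead_poly_op alpha (eq_leq (sr l)) (diffop_lead_id R).
have opM := diffop_lead_poly_op alpha sKk (diffop_lead_deriv opr).
apply: diffop_lead_widen (diffop_leadM _ opM).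
rewrite sP; move: sK sA S1 A1 K1.
move: (size S) (size (\det (casorati r'))) (\sum_(k < m) k)%N (\sum_l d l)%N
  (size (krallM r' S l)) => x y z t u; lia.
Qed.

Lemma exists_minimal_order (R : realType) (q : nat -> {poly R})
    (T : {poly R} -> {poly R}) (s : nat) :
  (0 < s)%N -> diffop_order T s -> eigenfunctions T q ->
  exists r : nat, minimal_order q r /\ (r <= s)%N.
Proof.
move=> s0 Ts Tq.
pose Q n := `[< (0 < n)%N /\
  exists T : {poly R} -> {poly R}, diffop_order T n /\ eigenfunctions T q >].
have Qs : Q s by apply/asboolP; split => //; exists T.
case: (ex_minnP (ex_intro _ s Qs)) => r /asboolP[r0 Tr] r_min.
exists r; split; last exact: r_min.
split=> // U t t0 Ut Uq; apply: r_min; apply/asboolP.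
by split => //; exists U.
Qed.

Theorem theorem1p3 (R : realType) (m alpha : nat) (M : 'M[R]_m) :
  (1 <= m)%N -> (0 < alpha)%N -> (m <= alpha)%N ->
  let B := sobolev_form alpha M in
  let q := qdet alpha M in
  let wr := alpha_wr alpha M in
  let P1 := exists p : nat -> {poly R}, left_orthogonal B p in
  let P2 := forall n : nat, (Omega alpha M).[n%:R] != 0 in
  (P1 <-> P2) /\
  (P1 \/ P2 ->
   [/\ left_orthogonal (fun f g => B g f) q,
       forall S : {poly R},
         (exists P : {poly R}, P - shiftp P (-1) = S * Omega alpha M) /\
         (forall P : {poly R}, P - shiftp P (-1) = S * Omega alpha M ->
            (exists c : R, forall n : nat,
               DS alpha M S P (q n) = (P.[n%:R] + c) *: q n) /\
            (S != 0 ->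
               exists s : nat,
                 s%:Z = 2 * ((size S).-1%:Z + wr + 1) /\
                 diffop_order (DS alpha M S P) s))
     & exists r : nat, minimal_order q r /\ r%:Z <= 2 * (wr + 1)]).
Proof.
move=> _ a0 le_ma B q wr P1 P2.
have P12 : P1 -> P2 by move=> [p Bp]; exact: Omega_nat_neq0 Bp.
have P21 : P2 -> P1.
  move=> O0; apply: (right_to_left_orthogonal (sobolev_linear_r alpha M)
    (sobolev_linear_l alpha M) (qdet_orthogonal le_ma O0)).
split=> // P1_or_P2; have O0 : P2 by case: P1_or_P2.
split; first exact: qdet_orthogonal.
  move=> S; split; first exact: fdiff_surj.
  move=> P dP; split.
    by exists 0 => n; rewrite addr0; exact: DS_qdet.
  move=> S0; have [ord degP] := DS_order a0 le_ma S0 dP.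
  by exists (size P).-1.*2; split => //; rewrite -mul2n PoszM degP.
have [P dP] := fdiff_surj (1 * Omega alpha M).
have [ord degP] := DS_order a0 le_ma (oner_neq0 _) dP.
rewrite size_poly1 /= add0r in degP.
have s0 : (0 < (size P).-1.*2)%N.
  have O1 : Omega alpha M != 0.
    by apply: contraNneq (O0 0%N) => ->; rewrite horner0.
  by rewrite (size_antidiff dP) mul1r // double_gt0 size_poly_gt0.
have Pq : eigenfunctions (DS alpha M 1 P) q.
  by move=> n; exists P.[n%:R]; exact: DS_qdet.
have [r [r_min le_r]] := exists_minimal_order s0 ord Pq.
by exists r; split => //; rewrite -degP -PoszM mul2n lez_nat.
Qed.
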